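(* Let $m,n$ be positive integers. For every $(m\times n)$-transportation polytope $T_{rc}$ with $(r,c)\neq(0,0)$, the toric ideal of $T_{rc}$ has a squarefree reduced Gröbner basis in degree $\left\lfloor\frac{m\cdot n}{2}\right\rfloor$; that is, there is a term order for which the reduced Gröbner basis of the toric ideal of $T_{rc}$ is squarefree and all its elements have degree at most $\left\lfloor\frac{m\cdot n}{2}\right\rfloor$.
   Context: $\mathbb{N}=\{0,1,2,\dots\}$, $k$ is a field. Transportation polytope: for $r\in\mathbb{N}^m$, $c\in\mathbb{N}^n$, $$T_{rc}=\Big\{A\in\mathbb{R}_{\ge0}^{m\times n}\ \Big|\ \sum_{i=1}^m a_{ij}=c_j\ \forall j,\ \sum_{j=1}^n a_{ij}=r_i\ \forall i\Big\}.$$ It is a lattice polytope. Toric ideal: for a lattice polytope $P\subseteq\mathbb{R}^N$ put $\mathcal{A}=P\cap\mathbb{Z}^N$. The toric ideal $I_P$ is the kernel of the $k$-algebra homomorphism $k[x_a : a\in\mathcal{A}]\to k[t_1^{\pm1},\dots,t_N^{\pm1}]$, $x_a\mapsto t^a$. A Gröbner basis is squarefree if the leading term of each of its elements is a squarefree monomial (up to a scalar). *)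

(* Defs.v *)
From HB Require Import structures.
From mathcomp Require Import all_boot all_order all_algebra.
From mathcomp Require Import finmap reals.
(* Imported without notations and before [monalg], so that unqualified names
   refer to [monalg].  It is used only for the ring k[t], because [monalg] has
   no integral domain instance. *)
From mathcomp.multinomials Require mpoly.
Import -(notations) mpoly.
From mathcomp.multinomials Require Import monalg.

Set Implicit Arguments.
Unset Strict Implicit.
Unset Printing Implicit Defensive.

Import GRing.Theory Num.Theory.
Local Open Scope ring_scope.

Section TransportationPolytope.
Variables (R : realType) (m n : nat).

Definition transportation_polytope (r : 'rV[nat]_m) (c : 'rV[nat]_n) :
    pred 'M[R]_(m, n) :=
  [pred A : 'M[R]_(m, n) |
    [&& [forall i, forall j, 0 <= A i j],
        [forall j, \sum_(i < m) A i j == (c 0 j)%:R] &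
        [forall i, \sum_(j < n) A i j == (r 0 i)%:R]]].

End TransportationPolytope.

Arguments transportation_polytope R {m n} r c.

Section ToricIdeal.
Variables (k : fieldType) (R : realType) (m n : nat) (P : pred 'M[R]_(m, n)).

Definition lattice_point : Type :=
  {a : 'M[int]_(m, n) | P (map_mx intr a)}.

(* The Laurent polynomial ring k[t_ij^{+-1}] is a subring of the field k(t_ij)
   of rational functions; [toric_map] is given the latter as its codomain,
   which does not change its kernel. *)
Definition ratfun : fieldType := {fraction (mpoly.mpoly (m * n) k)}.

Definition ratfun_const (a : k) : ratfun :=
  FracField.tofrac (mpoly.mpolyC (m * n) a).

Definition ratfun_var (i : 'I_m) (j : 'I_n) : ratfun :=
  FracField.tofrac (mpoly.mpolyX k (mpoly.mnm1 (mxvec_index i j))).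

Definition laurent_monomial (a : 'M[int]_(m, n)) : ratfun :=
  \prod_(i < m) \prod_(j < n) ratfun_var i j ^ a i j.

Definition toric_map : {malg k[{cmonom lattice_point}]} -> ratfun :=
  mmap ratfun_const
    (fun u : {cmonom lattice_point} =>
       \prod_(a <- finsupp u) laurent_monomial (val a) ^+ u a).

Definition toric_ideal (f : {malg k[{cmonom lattice_point}]}) : Prop :=
  toric_map f = 0.

End ToricIdeal.

Section GroebnerBases.
Variables (k : fieldType) (I : choiceType).
Local Notation mon := {cmonom I}.
Local Notation poly := {malg k[mon]}.
Implicit Types (le : rel mon) (u v w : mon) (f g h p q : poly).

(* For finitely many variables (as here) such an order is automatically a
   well-order. *)
Definition term_order le : Prop :=
  [/\ total le, antisymmetric le, transitive le,
      forall u, le mone u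
    & forall u v w, le u v -> le (mmul u w) (mmul v w)].

(* Meaningful when [le] is a term order, so that 1 is its least element;
   the zero polynomial gets the default value 1. *)
Definition lead_mon le f : mon :=
  \big[(fun u v => if le u v then v else u)/mone]_(u <- msupp f) u.

Definition lead_coeff le f : k := f@_(lead_mon le f).

Definition lead_term le f : poly := << lead_coeff le f *g lead_mon le f >>.

Definition ideal_gen (S : poly -> Prop) f : Prop :=
  exists2 s : seq (poly * poly),
    forall x, x \in s -> S x.2 & f = \sum_(x <- s) x.1 * x.2.

Definition initial_ideal le (J : poly -> Prop) : poly -> Prop :=
  ideal_gen (fun p => exists2 f, J f & p = lead_term le f).

Definition groebner_basis le (J : poly -> Prop) (G : {fset poly}) : Prop :=
  (forall g, g \in G -> J g) /\
  (forall p, ideal_gen (fun q => exists2 g, g \in G & q = lead_term le g) p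
             <-> initial_ideal le J p).

Definition mon_dvd u v : Prop := exists w, v = mmul u w.

Definition reduced_groebner_basis le (J : poly -> Prop) (G : {fset poly}) :
    Prop :=
  [/\ groebner_basis le J G,
      forall g, g \in G -> lead_coeff le g = 1
    & forall g h, g \in G -> h \in G -> g != h ->
        forall u, u \in msupp h -> ~ mon_dvd (lead_mon le g) u].

Definition squarefree_mon u : Prop := forall i, (u i <= 1)%N.

(* [msize g] is one more than the total degree of g, and 0 when g = 0. *)
Definition total_degree g : nat := (msize g).-1.

End GroebnerBases.

(* Main.v *)
Require Import Defs.
From HB Require Import structures.
From mathcomp Require Import all_boot all_order all_algebra.
From mathcomp Require Import finmap reals.
From mathcomp Require boolp.
From mathcomp Require Import zify.
From mathcomp.multinomials Require mpoly.
Import -(notations) mpoly.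
From mathcomp.multinomials Require Import monalg.

Set Implicit Arguments.
Unset Strict Implicit.
Unset Printing Implicit Defensive.

Import Order.TTheory GRing.Theory Num.Theory.
Local Open Scope ring_scope.

(** Order monomials by degree, then by the sum of the squared entries of the
    lattice points involved, then by reverse lexicographic order, where the
    lattice points themselves are ordered by a translation invariant
    (lexicographic) order on matrices.  The second criterion refines [T_rc] by
    the hyperplanes [a_ij = const]: the monomials minimizing it in their fiber
    are the "balanced" ones, whose matrices differ by at most 1 in each entry.

    Let [u] be a minimal generator of the initial ideal, of degree [d >= 3].
    Its quadratic divisors are standard, so [u] is balanced.  Let [s] be the
    first lattice point of the cell of [u]; it precedes all points of [u].
    Since [u / x_a] is standard for every [a] in [u], the point [s] does not
    lie in the cell of [u / x_a], so [a] has a private entry, where [a] alone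
    among the points of [u] agrees with [s].  In particular [u] is squarefree.

    If [n <= 4], the vanishing of the row sums of the matrices [a - s], whose
    entries have a fixed sign at each position, leaves at most [n / 2] private
    entries in each row.  If [n >= 5], let [a1] be the first point of [u] and
    [Z] a cycle conformal to [a1 - s].  As [s] is first in its cell, [s + Z]
    follows [s], so [a1 - Z] precedes [a1]; hence [a1 - Z] is not in the cell of
    [u / x_a], for [a <> a1], and [a] has a private entry on [Z].  As [Z] has at
    most two nonzero entries in each row, [d <= 2 m + 1 <= m n / 2]. *)

(** * Integer circulations and balanced families of matrices *)

(** With [lo] the least member of [xs], all of [xs] lies in {[lo], [lo + 1]}. On integers
    [g x = (x - lo)(x - lo - 1)] is nonnegative and vanishes exactly at these two values. Since
    [x ^+ 2] differs from [g x] by an affine function, the two sums of squares differ by the sum of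
    [g] over [ys]. *)
Lemma sum_sq_balanced (xs ys : seq int) :
    size xs = size ys -> \sum_(x <- xs) x = \sum_(x <- ys) x ->
    (forall x y, x \in xs -> y \in xs -> x <= y + 1) ->
  [/\ \sum_(x <- xs) x ^+ 2 <= \sum_(x <- ys) x ^+ 2,
      \sum_(x <- ys) x ^+ 2 <= \sum_(x <- xs) x ^+ 2 -> {subset ys <= xs}
    & {subset ys <= xs} -> \sum_(x <- ys) x ^+ 2 = \sum_(x <- xs) x ^+ 2].
Proof.
move=> hs hS hb.
have [xs0|[lo lox lomin]] : xs = [::] \/
    exists2 lo, lo \in xs & forall x, x \in xs -> lo <= x.
  case: (xs) => [|x0 s]; [by left|right].
  elim: s => [|x s [lo h1 h2]]; first by exists x0 => [|x];
    rewrite inE // => /eqP->.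
  case: (lerP lo x) => hx.
    exists lo => [|z]; first by move: h1; rewrite !inE => /orP[]->;
      rewrite ?orbT.
    rewrite !inE orbCA => /orP[/eqP->//|hz]; apply: h2; by rewrite inE.
  exists x => [|z]; first by rewrite !inE eqxx orbT.
  rewrite !inE orbCA => /orP[/eqP->//|hz]; apply: (le_trans (ltW hx)).
  by apply: h2; rewrite inE.
  by rewrite xs0 in hs *; case: (ys) hs => // _; rewrite !big_nil.
pose g x : int := (x - lo) * (x - lo - 1).
have g0 x : 0 <= g x.
  rewrite /g; case: (lerP (lo + 1) x) => h; first by apply: mulr_ge0; lia.
  by apply: mulr_le0; lia.
have gx x : x \in xs -> g x = 0.
  move=> hx; have h1 := lomin _ hx; have h2 := hb _ _ hx lox.
  have [->|->] : x = lo \/ x = lo + 1 by lia.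
    by rewrite /g subrr mul0r.
  by rewrite /g [lo + 1]addrC addrK subrr mulr0.
have sumg (zs : seq int) : \sum_(x <- zs) x ^+ 2 = \sum_(x <- zs) g x
   + (lo *+ 2 + 1) * (\sum_(x <- zs) x) - (lo ^+ 2 + lo) * (size zs)%:Z.
  elim: zs => [|z zs IH]; first by rewrite !big_nil !mulr0 subr0.
  rewrite !big_cons IH {2}/g /= -[(size zs).+1]addn1 PoszD.
  move: (\sum_(x <- zs) g x) (\sum_(x <- zs) _) (Posz (size zs)) => A B C.
  rewrite mulr2n; lia.
have gxs : \sum_(x <- xs) g x = 0 by apply: big1_seq => x /andP[_ /gx].
have hd : \sum_(x <- ys) x ^+ 2 = \sum_(x <- xs) x ^+ 2 + \sum_(x <- ys) g x.
  by rewrite !sumg gxs hs hS; lia.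
have gys : 0 <= \sum_(x <- ys) g x by apply: sumr_ge0.
split; first by rewrite hd lerDl.
- rewrite hd gerDl => h.
  have gy y : y \in ys -> g y = 0.
    have : \sum_(x <- ys) g x == 0 by rewrite eq_le h gys.
    by rewrite psumr_eq0 // => /allP H /H /implyP/(_ isT)/eqP.
  have y01 y : y \in ys -> y = lo \/ y = lo + 1.
    by move=> /gy; rewrite /g => /eqP; rewrite mulf_eq0 => /orP[]/eqP; lia.
  (* If [lo + 1] is missing from [xs], all of [xs] equals [lo], and the equal sums force every [y]
     to be [lo] too. *)
  case: (boolP (lo + 1 \in xs)) => hx.
    by move=> y /y01[]->.
  have xlo x : x \in xs -> x = lo.
    move=> xx; have := lomin _ xx; have := hb _ _ xx lox.
    have : x != lo + 1 by apply: contraNneq hx => <-.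
    lia.
  have sumB (zs : seq int) :
      \sum_(x <- zs) (x - lo) = \sum_(x <- zs) x - lo * (size zs)%:Z.
    elim: zs => [|z zs IH]; first by rewrite !big_nil mulr0 subr0.
    by rewrite !big_cons IH /= -[(size zs).+1]addn1 PoszD; lia.
  have : \sum_(x <- ys) (x - lo) == 0.
    rewrite sumB -hS -hs -sumB big1_seq // => x /andP[_ /xlo->].
    by rewrite subrr.
  rewrite big_seq psumr_eq0 => [/allP H y hy|y /y01[]->]; [|lia|lia].
  have /implyP/(_ hy) := H _ hy; rewrite subr_eq0 => /eqP->; exact: lox.
- move=> hsub; rewrite hd [X in _ + X]big1_seq ?addr0 // => y /andP[_
    /hsub/gx]//.
Qed.

Section Margins.
Variables m n : nat.
Implicit Types (a b y Z : 'M[int]_(m, n)) (w : seq 'M[int]_(m, n)).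

(** Packing both kinds of sums into one additive map makes the integer circulations its kernel. *)
Definition margins a : 'cV[int]_m * 'rV[int]_n :=
  (\col_i \sum_j a i j, \row_j \sum_i a i j).

Lemma sub_mxE a b i j : (a - b) i j = a i j - b i j.
Proof. by rewrite !mxE. Qed.

Lemma add_mxE a b i j : (a + b) i j = a i j + b i j.
Proof. by rewrite !mxE. Qed.

Lemma margins_is_additive : zmod_morphism margins.
Proof.
move=> a b; congr (_, _); apply/matrixP=> i j; rewrite !mxE -sumrB;
  by apply: eq_bigr => k _; rewrite !mxE.
Qed.
HB.instance Definition _ :=
  GRing.isZmodMorphism.Build 'M[int]_(m, n) ('cV[int]_m * 'rV[int]_n)%type
    margins margins_is_additive.

Lemma circ_row y i : margins y = 0 -> \sum_j y i j = 0.
Proof. by case=> /matrixP/(_ i 0); rewrite !mxE. Qed.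

Lemma circ_col y j : margins y = 0 -> \sum_i y i j = 0.
Proof. by case=> _ /matrixP/(_ 0 j); rewrite !mxE. Qed.

Lemma margins_delta i j :
  margins (delta_mx i j) = (delta_mx i 0, delta_mx 0 j).
Proof.
congr (_, _); apply/matrixP=> k l; rewrite !mxE.
  rewrite (bigD1 j) //= mxE eqxx andbT big1 ?addr0 ?ord1 ?eqxx ?andbT //.
  by move=> h hj; rewrite mxE (negPf hj) andbF.
rewrite (bigD1 i) //= mxE eqxx /= big1 ?addr0 ?ord1 ?eqxx //.
by move=> h hj; rewrite mxE (negPf hj).
Qed.

(** Subtracting such a sign matrix moves no entry of [y] past 0. For [y = a - b], the matrices
    [a - Z] and [b + Z] thus stay entrywise between [a] and [b]. *)
Definition conformal Z y : Prop := forall i j,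
  [\/ Z i j = 0, Z i j = 1 /\ 1 <= y i j | Z i j = -1 /\ y i j <= -1].

Lemma sum0_pos (I : finType) (F : I -> int) i0 :
  \sum_i F i = 0 -> F i0 != 0 -> exists i, 0 < F i.
Proof.
move=> h h0; case: (pickP (fun i => 0 < F i)) => [i hi|hn]; first by exists i.
have hle i : F i <= 0 by rewrite leNgt hn.
have : \sum_i - F i == 0 by rewrite sumrN h oppr0.
rewrite psumr_eq0 => [/allP/(_ i0 (mem_index_enum _))|i _]; last first.
  by rewrite oppr_ge0.
by rewrite oppr_eq0 (negPf h0).
Qed.

Lemma sum0_neg (I : finType) (F : I -> int) i0 :
  \sum_i F i = 0 -> F i0 != 0 -> exists i, F i < 0.
Proof.
move=> h h0; have [||i hi] := @sum0_pos I (fun i => - F i) i0.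
- by rewrite sumrN h oppr0.
- by rewrite oppr_eq0.
- by exists i; rewrite -oppr_gt0.
Qed.

(* Follow a positive entry of a row and then a negative entry of its column;
   on a minimal nonempty set of rows stable under this map the map is
   bijective, so the corresponding +1 and -1 cancel in every row. *)
Lemma conformal_cycle y : margins y = 0 -> y != 0 ->
  exists Z, [/\ margins Z = 0, Z != 0, conformal Z y
    & forall i, (#|[set j | Z i j != 0%R]| <= 2)%N].
Proof.
move=> hy y0.
have [i0 [j0 hij0]] : exists i j, y i j != 0.
  case: (pickP (fun e : 'I_m * 'I_n => y e.1 e.2 != 0)) => [e he|h].
    by exists e.1, e.2.
  case/eqP: y0; apply/matrixP=> i j; rewrite mxE.
  by have /negbFE/eqP := h (i, j).
pose jj i := odflt j0 [pick j | 0 < y i j].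
pose nxt j := odflt i0 [pick i | y i j < 0].
pose f i := nxt (jj i).
pose R := [set i | [exists j, y i j != 0]].
have jjP i : i \in R -> 0 < y i (jj i).
  rewrite inE => /existsP[j hj].
  have [j1 hj1] := sum0_pos (circ_row i hy) hj.
  by rewrite /jj; case: pickP => [//|/(_ j1)]; rewrite hj1.
have fP i : i \in R -> y (f i) (jj i) < 0.
  move=> /jjP hi; have [k hk] := sum0_neg (circ_col (jj i) hy) (lt0r_neq0 hi).
  by rewrite /f /nxt; case: pickP => [//|/(_ k)]; rewrite hk.
have fR i : i \in R -> f i \in R.
  by move=> /fP hi; rewrite inE; apply/existsP; exists (jj i);
    rewrite ltr0_neq0.
pose good (S : {set 'I_m}) := [&& S != set0, S \subset R & f @: S \subset S].
have hR : good R.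
  apply/and3P; split => //.
    by apply/set0Pn; exists i0; rewrite inE; apply/existsP; exists j0.
  by apply/subsetP=> _ /imsetP[i hi ->]; apply: fR.
have [S /minsetP[/and3P[S0 SR fS] minS] _] := minset_exists hR.
have fSS : f @: S = S.
  apply: minS => //; apply/and3P; split.
  - by case/set0Pn: S0 => i hi; apply/set0Pn; exists (f i); apply: imset_f.
  - exact: subset_trans fS SR.
  - exact: imsetS.
have finj : {in S &, injective f} by apply/imset_injP; rewrite fSS.
have sR i : i \in S -> i \in R by move/(subsetP SR).
pose Z := \sum_(k in S) (delta_mx k (jj k) - delta_mx (f k) (jj k))
  : 'M[int]_(m, n).
pose P i j := (i \in S) && (j == jj i).
pose N i j := [exists k, (k \in S) && ((i == f k) && (j == jj k))].
have ZE i j : Z i j = (P i j)%:R - (N i j)%:R.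
  rewrite /Z summxE (eq_bigr (fun k => ((i == k) && (j == jj k))%:R
     - ((i == f k) && (j == jj k))%:R)); last by move=> k _; rewrite !mxE.
  rewrite sumrB; congr (_ - _).
    rewrite /P; case: (boolP (i \in S)) => iS /=; last first.
      by rewrite big1 // => k kS; case: eqP => // ik; rewrite ik kS in iS.
    rewrite (bigD1 i) //= eqxx big1 ?addr0 // => k /andP[_ ki].
    by rewrite eq_sym (negPf ki).
  rewrite /N; case: existsP => [[k /andP[kS /andP[ik jk]]]|h].
    rewrite (bigD1 k) //= ik jk big1 ?addr0 // => h /andP[hS hk].
    case: eqP => // ih; case/eqP: hk; apply: finj => //.
    by rewrite -ih (eqP ik).
  by rewrite big1 // => k kS; case e: (_ && _) => //; case: h; exists k;
    rewrite kS e.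
have Ppos i j : P i j -> 1 <= y i j.
  by case/andP=> /sR/jjP h /eqP->; lia.
have Nneg i j : N i j -> y i j <= -1.
  by case/existsP=> k /andP[/sR/fP h /andP[/eqP-> /eqP->]]; lia.
exists Z; split.
(* Each summand has zero column sums; the row sums cancel after reindexing along the bijection [f]
   of [S]. *)
- rewrite /Z raddf_sum /= (eq_bigr (fun k =>
    (delta_mx k 0, 0) - (delta_mx (f k) 0, 0) : 'cV[int]_m * 'rV[int]_n));
    last first.
    move=> k _; rewrite raddfB /= !margins_delta; congr (_, _).
    by rewrite !subrr.
  rewrite sumrB /=.
  have := big_imset (fun k => (delta_mx k 0, 0) : 'cV[int]_m * 'rV[int]_n) finj.
  by rewrite fSS => <-; rewrite subrr.
- case/set0Pn: S0 => i iS; apply/eqP=> /matrixP/(_ i (jj i)).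
  rewrite ZE mxE; have Pi : P i (jj i) by rewrite /P iS eqxx.
  have := @Nneg i (jj i); have := Ppos _ _ Pi; rewrite Pi.
  by case: (N i (jj i)) => // h1 /(_ isT) h2; lia.
- move=> i j; rewrite ZE; move: (@Nneg i j) (@Ppos i j).
  case: (P i j); case: (N i j) => h1 h2.
  + have := h1 isT; have := h2 isT; lia.
  + by apply: Or32; split; [|exact: h2].
  + by apply: Or33; split; [|exact: h1].
  + by apply: Or31.
(* Row [i] of [S] carries its +1 at [jj i] and its -1 at [jj k], where [k] is the preimage of [i]
   under [f]; the other rows are zero. *)
- move=> i; case: (boolP (i \in S)) => iS; last first.
    rewrite (_ : [set j | _] = set0) ?cards0 //; apply/setP=> j.
    rewrite !inE ZE /P (negPf iS) /= sub0r oppr_eq0.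
    apply/negbTE; rewrite negbK /N; case: existsP => // -[k /andP[kS]].
    case/andP=> /eqP ik _; case/negP: iS; rewrite ik -fSS; exact: imset_f.
  have /imsetP[k kS ik] : i \in f @: S by rewrite fSS.
  apply: leq_trans (_ : #|[set jj i; jj k]| <= 2)%N; last first.
    by rewrite cards2; case: (_ != _).
  apply/subset_leq_card/subsetP=> j; rewrite !inE ZE /P iS /=.
  case: (j == jj i) => //=; rewrite sub0r oppr_eq0 /N.
  case: existsP => // -[h /andP[hS /andP[/eqP ih /eqP jh]]] _.
  by rewrite jh; apply/eqP; congr jj; apply: finj => //; rewrite -ih.
Qed.

(** Subtract conformal cycles until one passes through the given entry. The sum of absolute values
    drops each time, the entry at [(i, j)] is untouched by cycles missing it, and a cycle conformal
    to [y - Z] is conformal to [y]. *)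
Lemma conformal_cycle_through y i j : margins y = 0 -> y i j != 0 ->
  exists Z, [/\ margins Z = 0, conformal Z y & Z i j != 0].
Proof.
have [k] := ubnP (\sum_e `|y e.1 e.2|)%N.
elim: k y => // k IH y hk hy yij.
have y0 : y != 0 by apply: contraNneq yij => ->; rewrite mxE.
have [Z [mZ Z0 cZ _]] := conformal_cycle hy y0.
case: (eqVneq (Z i j) 0) => [Zij|Zij]; last by exists Z.
have le e : (`|(y - Z)%R e.1 e.2| <= `|y e.1 e.2|)%N.
  by rewrite ?(sub_mxE, add_mxE); case: (cZ e.1 e.2) => [->|[-> ?]|[-> ?]]; lia.
have [||| Z' [mZ' cZ' Z'0]] := IH (y - Z).
- suff : (\sum_e `|(y - Z)%R e.1 e.2| < \sum_e `|y e.1 e.2|)%N.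
    by move=> h; apply: leq_trans h _.
  have [e he] : exists e, Z e.1 e.2 != 0.
    case: (pickP (fun e => Z e.1 e.2 != 0)) => [e he|h]; first by exists e.
    case/eqP: Z0; apply/matrixP=> i' j'; rewrite mxE.
    by have /negbFE/eqP := h (i', j').
  rewrite (bigD1 e) //= [ltnRHS](bigD1 e) //= -addSn leq_add //.
    by rewrite ?(sub_mxE, add_mxE); case: (cZ e.1 e.2) he => [->//|[-> ? _]|[->
      ? _]]; lia.
  by apply: leq_sum => e' _; apply: le.
- by rewrite raddfB /= hy mZ subr0.
- by rewrite ?(sub_mxE, add_mxE) Zij subr0.
exists Z'; split=> // i' j'; case: (cZ' i' j') => [->|[-> h]|[-> h]].
- exact: Or31.
- by apply: Or32; split=> //; move: h; rewrite ?(sub_mxE, add_mxE);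
    case: (cZ i' j') => [->|[-> ?]|[-> ?]]; lia.
- by apply: Or33; split=> //; move: h; rewrite ?(sub_mxE, add_mxE);
    case: (cZ i' j') => [->|[-> ?]|[-> ?]]; lia.
Qed.

Definition sqnorm a : int := \sum_e a e.1 e.2 ^+ 2.

Definition weight w : int := \sum_(a <- w) sqnorm a.

Definition balanced w : bool :=
  all (fun a => all (fun b => [forall i, forall j, a i j <= b i j + 1]) w) w.

Lemma balancedP w : reflect
  (forall a b, a \in w -> b \in w -> forall i j, a i j <= b i j + 1) (balanced
    w).
Proof.
apply: (iffP allP) => [h a b aw bw i j|h a aw].
  by have /allP/(_ _ bw)/forallP/(_ i)/forallP/(_ j) := h a aw.
by apply/allP=> b bw; apply/forallP=> i; apply/forallP=> j; apply: h.
Qed.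

Lemma sqnorm_ge0 a : 0 <= sqnorm a.
Proof. by apply: sumr_ge0 => e _; apply: sqr_ge0. Qed.

Lemma weight_ge0 w : 0 <= weight w.
Proof. by apply: sumr_ge0 => a _; apply: sqnorm_ge0. Qed.

Lemma weight_cons a w : weight (a :: w) = sqnorm a + weight w.
Proof. by rewrite /weight big_cons. Qed.

Lemma weight_perm w w' : perm_eq w w' -> weight w = weight w'.
Proof. exact: perm_big. Qed.

Lemma sum_perm w w' : perm_eq w w' -> \sum_(a <- w) a = \sum_(a <- w') a.
Proof. exact: perm_big. Qed.

(** Move along a cycle through [(i, j)] conformal to [a - b]. No position gains in the sum of
    squares, and [(i, j)], where the gap is at least 2, loses strictly. The last clause serves to
    preserve nonnegativity. *)
Lemma exchange_pair a b i j : margins a = margins b -> b i j + 1 < a i j ->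
  exists a' b', [/\ a' + b' = a + b, margins a' = margins a,
    margins b' = margins a, sqnorm a' + sqnorm b' < sqnorm a + sqnorm b
  & forall x, x \in [:: a'; b'] ->
      forall k l, a k l <= x k l \/ b k l <= x k l].
Proof.
move=> hab hij.
have [||Z [mZ cZ Zij]] := @conformal_cycle_through (a - b) i j.
- by rewrite raddfB /= hab subrr.
- by rewrite ?(sub_mxE, add_mxE); lia.
exists (a - Z), (b + Z); split.
- by rewrite addrACA addNr addr0.
- by rewrite raddfB /= mZ subr0.
- by rewrite raddfD /= mZ addr0 hab.
- rewrite -!big_split /= (bigD1 (i, j)) //= [ltRHS](bigD1 (i, j)) //=.
  rewrite ltr_leD //.
    rewrite ?(sub_mxE, add_mxE); have := cZ i j;
      rewrite ?(sub_mxE, add_mxE) => -[h|[h ?]|[h ?]].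
    + by rewrite h eqxx in Zij.
    + rewrite h; nia.
    + rewrite h; nia.
  apply: ler_sum => -[k l] _ /=; rewrite ?(sub_mxE, add_mxE).
  have := cZ k l; rewrite ?(sub_mxE, add_mxE) => -[->|[-> ?]|[-> ?]]; nia.
- move=> x; rewrite !inE => hx k l.
  have := cZ k l; case/orP: hx => /eqP ->; rewrite ?(sub_mxE, add_mxE);
    case=> [->|[-> ?]|[-> ?]]; lia.
Qed.

(** Each exchange lowers the nonnegative integer [weight], so repeating it terminates. The family
    ranges over all integer matrices, because [complete_fit] starts from one that may have negative
    entries. *)
Lemma exists_balanced w mu : (forall a, a \in w -> margins a = mu) ->
  exists w', [/\ size w' = size w, \sum_(a <- w') a = \sum_(a <- w) a,
    forall a, a \in w' -> margins a = mu & balanced w'].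
Proof.
have [k] := ubnP `|weight w|%N.
elim: k w => // k IH w hk hw.
case: (boolP (balanced w)) => [bw|]; first by exists w.
case/allPn=> a aw /allPn[b bw /forallPn[i /forallPn[j]]].
rewrite -ltNge => hij.
have ab : b != a by apply: contraTneq hij => ->; lia.
have [|a' [b' [s1 ma mb lt _]]] := exchange_pair _ hij; first by rewrite !hw.
have hp : perm_eq w [:: a, b & rem b (rem a w)].
  by rewrite (perm_trans (perm_to_rem aw)) // perm_cons perm_to_rem // rem_mem.
have sw : size w = size [:: a, b & rem b (rem a w)] by apply: perm_size.
have [||w' [z1 z2 z3 z4]] := IH [:: a', b' & rem b (rem a w)].
- suff : weight [:: a', b' & rem b (rem a w)] < weight w.
    by have := weight_ge0 [:: a', b' & rem b (rem a w)];
       have := weight_ge0 w; lia.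
  by rewrite (weight_perm hp) !weight_cons; lia.
- move=> x; rewrite !inE => /or3P[/eqP->|/eqP->|hx].
  + by rewrite ma hw.
  + by rewrite mb hw.
  + by apply: hw; apply: mem_rem (mem_rem hx).
exists w'; split=> //; first by rewrite z1 sw.
by rewrite z2 (sum_perm hp) !big_cons !addrA s1.
Qed.

End Margins.

(** * Counting private entries *)

Section RowBound.
Variables (d n : nat).

Lemma card_pos_neg (f : 'I_n -> int) :
  \sum_j f j = 0 -> (forall j, -1 <= f j <= 1) ->
  #|[set j | f j == 1]| = #|[set j | f j == -1]|.
Proof.
move=> h0 h1.
have : \sum_j f j = #|[set j | f j == 1]|%:R - #|[set j | f j == -1]|%:R.
  rewrite -!sum1_card !natr_sum !(big_mkcond (fun j => j \in _)) /= -sumrB.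
  apply: eq_bigr => j _; rewrite !inE; have := h1 j.
  by case: eqP => [->|?]; [|case: eqP => [->|?]] => //=; lia.
by rewrite h0 => /esym/subr0_eq/eqP; rewrite eqr_nat => /eqP.
Qed.

(** A vector outside [L] is 1 on all of [c @: L]; having sum 0, it has as many entries -1, and these
    lie off [c @: L]. *)
Lemma private_pos_bound (r : 'I_d -> 'I_n -> int) (L : {set 'I_d})
    (c : 'I_d -> 'I_n) :
    (n <= 4)%N -> (2 < d)%N ->
    (forall l, \sum_j r l j = 0) ->
    (forall l l' j, r l j <= r l' j + 1) ->
    (forall l j, -1 <= r l j <= 1) ->
    (forall l, l \in L -> r l (c l) = 0) ->
    (forall l l', l \in L -> l' != l -> r l' (c l) = 1) ->
  (2 * #|L| <= n)%N.
Proof.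
move=> n4 d3 r0 rd r1 rp rq.
have cinj : {in L &, injective c}.
  move=> l l' lL l'L hc; apply/eqP; apply/negPn/negP=> ne.
  by have := rq _ _ l'L ne; rewrite -hc rp.
case: (boolP [exists l, l \notin L]) => [/existsP[l lL]|hall].
  have dis : [disjoint c @: L & [set j | r l j == -1]].
    rewrite -setI_eq0; apply/eqP/setP=> j; rewrite !inE.
    apply/negbTE/negP=> /andP[/imsetP[l' l'L ->]] /eqP h.
    have ne : l != l' by apply: contraNneq lL => ->.
    by have := rq _ _ l'L ne; rewrite h.
  have hle : (#|c @: L| <= #|[set j | r l j == 1%R]|)%N.
    apply/subset_leq_card/subsetP=> _ /imsetP[l' l'L ->]; rewrite inE rq //.
    by apply: contraNneq lL => ->.
  have : (#|c @: L :|: [set j | r l j == -1%R]| <= n)%N.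
    by rewrite -[X in (_ <= X)%N](card_ord n) max_card.
  move: dis; rewrite -leq_card_setU => /eqP->.
  move: hle; rewrite (card_pos_neg (r0 l) (r1 l)) card_in_imset //.
  by move: #|L| #|_| => p q; lia.
(* If [L] is everything, any vector has [d - 1] entries 1 on [c @: L], hence at least [d - 1]
   entries -1 elsewhere. Then [2 d - 1 <= n <= 4], against [d >= 3]. *)
have LT l : l \in L by apply/negPn/negP=> hl; case/existsP: hall; exists l.
have cardL : #|L| = d.
  by rewrite (_ : L = setT) ?cardsT ?card_ord //; apply/setP=> l;
    rewrite LT inE.
have d0 : (0 < d)%N by lia.
pose a := Ordinal d0.
have dis : [disjoint c @: L & [set j | r a j == -1]].
  rewrite -setI_eq0; apply/eqP/setP=> j; rewrite !inE.
  apply/negbTE/negP=> /andP[/imsetP[l' l'L ->]] /eqP h.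
  case: (eqVneq a l') => [e|ne]; last by have := rq _ _ l'L ne; rewrite h.
  by have := rp _ l'L; rewrite -{1}e h.
have hle : (#|c @: (L :\ a)| <= #|[set j | r a j == 1%R]|)%N.
  apply/subset_leq_card/subsetP=> _ /imsetP[l' hl ->].
  by move: hl; rewrite !inE => /andP[ne l'L]; rewrite rq // eq_sym.
have : (#|c @: L :|: [set j | r a j == -1%R]| <= n)%N.
  by rewrite -[X in (_ <= X)%N](card_ord n) max_card.
move: dis; rewrite -leq_card_setU => /eqP->.
have cinj' : {in L :\ a &, injective c}.
  by move=> x z; rewrite !inE => /andP[_ hx] /andP[_ hz]; apply: cinj.
move: hle; rewrite (card_pos_neg (r0 a) (r1 a)) !card_in_imset // => hle.
have := cardsD1 a L; rewrite LT cardL => h1.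
by move: #|_| #|_| h1 hle => p q; lia.
Qed.

(** At a private position the other vectors are nonzero and differ by at most 1, so they share a
    sign; [Lp] and [Lm] split [L] by this sign. If one class is empty, [private_pos_bound] applies
    up to negation. *)
Lemma private_row_bound (r : 'I_d -> 'I_n -> int) (L : {set 'I_d})
    (c : 'I_d -> 'I_n) :
    (n <= 4)%N -> (2 < d)%N ->
    (forall l, \sum_j r l j = 0) ->
    (forall l l' j, r l j <= r l' j + 1) ->
    (forall l j, -1 <= r l j <= 1) ->
    (forall l, l \in L -> r l (c l) = 0) ->
    (forall l l', l \in L -> l' != l -> r l' (c l) != 0) ->
  (2 * #|L| <= n)%N.
Proof.
move=> n4 d3 r0 rd r1 rp rq.
pose Lp := [set l in L | [forall l', (l' != l) ==> (r l' (c l) == 1)]].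
pose Lm := [set l in L | [forall l', (l' != l) ==> (r l' (c l) == -1)]].
have LpP l l' : l \in Lp -> l' != l -> r l' (c l) = 1.
  by rewrite inE => /andP[_ /forallP/(_ l')/implyP h] /h/eqP.
have LmP l l' : l \in Lm -> l' != l -> r l' (c l) = -1.
  by rewrite inE => /andP[_ /forallP/(_ l')/implyP h] /h/eqP.
have LpL l : l \in Lp -> l \in L by rewrite inE => /andP[].
have LmL l : l \in Lm -> l \in L by rewrite inE => /andP[].
have cinj : {in L &, injective c}.
  move=> l l' lL l'L hc; apply/eqP; apply/negPn/negP=> ne.
  by have := rq _ _ l'L ne; rewrite -hc rp.
have LU l : l \in L -> (l \in Lp) || (l \in Lm).
  move=> lL; rewrite !inE lL /=.
  case: (boolP [forall l', (l' != l) ==> (r l' (c l) == 1)]) => //=.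
  case/forallPn=> k; rewrite negb_imply => /andP[kl hk].
  apply/forallP=> l'; apply/implyP=> hl'.
  have := rq _ _ lL kl; have := rq _ _ lL hl'.
  have := r1 k (c l); have := r1 l' (c l).
  by have := rd k l' (c l); have := rd l' k (c l); lia.
have cardL : (#|L| <= #|Lp| + #|Lm|)%N.
  apply: leq_trans (leq_card_setU Lp Lm); apply/subset_leq_card/subsetP=> l.
  by move/LU; rewrite in_setU.
have [Lp0|[a aL]] := set_0Vmem Lp.
  apply: (@private_pos_bound (fun l j => - r l j) L c) => //.
  - by move=> l; rewrite sumrN r0 oppr0.
  - by move=> l l' j; have := rd l' l j; lia.
  - by move=> l j; have := r1 l j; lia.
  - by move=> l /rp->; rewrite oppr0.
  - move=> l l' /LU; rewrite Lp0 in_set0 /= => lm ne.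
    by rewrite (LmP _ _ lm ne) opprK.
have [Lm0|[b bL]] := set_0Vmem Lm.
  apply: (@private_pos_bound r L c) => //.
  by move=> l l' /LU; rewrite Lm0 in_set0 orbF => lm ne; apply: LpP.
have ab : a != b.
  apply: contraTneq bL => <-; apply/negP => aM.
  have [k ka] : exists k, k != a.
    have d0 : (0 < d)%N by lia.
    have d1 : (1 < d)%N by lia.
    case: (eqVneq (Ordinal d0) a) => [e|]; last by exists (Ordinal d0).
    by exists (Ordinal d1); rewrite -e.
  by have := LpP _ _ aL ka; rewrite (LmP _ _ aM ka).
have ba : b != a by rewrite eq_sym.
pose EP := [set j | [exists l, r l j == 1]].
pose EM := [set j | [exists l, r l j == -1]].
have dis : (#|EP| + #|EM| <= n)%N.
  have : [disjoint EP & EM].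
    rewrite -setI_eq0; apply/eqP/setP=> j; rewrite !inE.
    apply/negbTE/negP=> /andP[/existsP[l /eqP h] /existsP[l' /eqP h']].
    by have := rd l l' j; rewrite h h'.
  rewrite -leq_card_setU => /eqP <-; rewrite -[X in (_ <= X)%N](card_ord n).
  exact: max_card.
(* The vector of [a] is -1 at the private positions of [Lm], so it has at least [#|Lm|] entries 1.
   The position [c a] also belongs to [EP], but there the vector of [a] is 0, so the inequality is
   strict. *)
have hm : (#|Lm| < #|EP|)%N.
  apply: (@leq_ltn_trans #|[set j | r a j == -1]|).
    rewrite -(card_in_imset (f := c)); last by move=> x y /LmL hx /LmL;
      apply: cinj.
    apply/subset_leq_card/subsetP=> _ /imsetP[l lL ->]; rewrite inE LmP //.
    apply: contraTneq lL => <-; apply/negP=> aM.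
    by have := LpP _ _ aL ba; rewrite (LmP _ _ aM ba).
  rewrite -(card_pos_neg (r0 a) (r1 a)).
  rewrite [ltnRHS](cardsD1 (c a)) inE.
  have -> : [exists l, r l (c a) == 1].
    by apply/existsP; exists b; rewrite (LpP a) // eq_sym.
  rewrite add1n ltnS; apply/subset_leq_card/subsetP=> j; rewrite !inE => hj.
  rewrite (_ : j != c a) /=; last first.
    by apply: contraTneq hj => ->; rewrite rp // LpL.
  by apply/existsP; exists a.
have hp : (#|Lp| < #|EM|)%N.
  apply: (@leq_ltn_trans #|[set j | r b j == 1]|).
    rewrite -(card_in_imset (f := c)); last by move=> x y /LpL hx /LpL;
      apply: cinj.
    apply/subset_leq_card/subsetP=> _ /imsetP[l lL ->]; rewrite inE LpP //.
    apply: contraTneq lL => <-; apply/negP=> aM.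
    by have := LmP _ _ bL ab; rewrite (LpP _ _ aM ab).
  rewrite (card_pos_neg (r0 b) (r1 b)).
  rewrite [ltnRHS](cardsD1 (c b)) inE.
  have -> : [exists l, r l (c b) == -1].
    by apply/existsP; exists a; rewrite (LmP b).
  rewrite add1n ltnS; apply/subset_leq_card/subsetP=> j; rewrite !inE => hj.
  rewrite (_ : j != c b) /=; last first.
    by apply: contraTneq hj => ->; rewrite rp // LmL.
  by apply/existsP; exists b.
(* Altogether [#|L| + 2 <= #|EP| + #|EM| <= n], and [2 (n - 2) <= n] because [n <= 4]. *)
lia.
Qed.

End RowBound.

(** Group the members by the row of their private entry and sum [private_row_bound] over the
    rows. *)
Lemma private_entries_bound m n d (y : 'I_d -> 'M[int]_(m, n))
    (e : 'I_d -> 'I_m * 'I_n) :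
    (n <= 4)%N -> (2 < d)%N ->
    (forall l, margins (y l) = 0) ->
    (forall l l' i j, y l i j <= y l' i j + 1) ->
    (forall l i j, -1 <= y l i j <= 1) ->
    (forall l, y l (e l).1 (e l).2 = 0) ->
    (forall l l', l' != l -> y l' (e l).1 (e l).2 != 0) ->
  (d <= (m * n)./2)%N.
Proof.
move=> n4 d3 y0 yd y1 yp yq.
suff : (2 * d <= m * n)%N by lia.
have -> : d = (\sum_(i < m) #|[set l | (e l).1 == i]|)%N.
  rewrite -[LHS]card_ord -sum1_card (partition_big (fun l => (e l).1) predT)
    //=.
  by apply: eq_bigr => i _; rewrite -sum1_card; apply: eq_bigl => l;
    rewrite inE.
rewrite big_distrr /= -[X in (_ <= X * _)%N](card_ord m) -sum_nat_const.
apply: leq_sum => i _.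
apply: (@private_row_bound d n (fun l j => y l i j) _ (fun l => (e l).2)) => //.
- by move=> l; apply: circ_row.
- by move=> l; rewrite inE => /eqP <-.
- by move=> l l'; rewrite inE => /eqP <-; apply: yq.
Qed.

(** * Minimal reducible families of lattice points *)

Definition lexlt (x y : seqlexi int) : bool := (x < y)%O.

Lemma lexlt_cons (x y : int) (xs ys : seq int) :
  lexlt (x :: xs) (y :: ys) = (x < y) || (x == y) && lexlt xs ys.
Proof. by rewrite /lexlt ltxi_cons; case: (ltgtP x y). Qed.

(** Source of the translation invariance of both the order on matrices and the order on monomials,
    which compare additive keys. *)
Lemma lexlt_translate (T : Type) (s : seq T) (f g h : T -> int) :
  lexlt [seq f x + h x | x <- s] [seq g x + h x | x <- s] =
  lexlt [seq f x | x <- s] [seq g x | x <- s].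
Proof.
by elim: s => //= x s IH; rewrite !lexlt_cons IH ltrD2r (inj_eq (addIr _)).
Qed.

Lemma exists_minimal (T : eqType) (r : rel T) (u : seq T) :
    irreflexive r -> transitive r -> u != [::] ->
  exists2 x, x \in u & forall y, y \in u -> ~~ r y x.
Proof.
move=> rirr rtr; elim: u => // a u IH _.
case: (eqVneq u [::]) => [->|/IH[x xu hx]].
  exists a => [|y]; first by rewrite inE.
  by rewrite inE => /eqP->; rewrite rirr.
case: (boolP (r a x)) => h.
  exists a => [|y]; first by rewrite inE eqxx.
  rewrite inE => /orP[/eqP->|/hx]; first by rewrite rirr.
  by apply: contra => h'; apply: rtr h' h.
exists x => [|y]; first by rewrite inE xu orbT.
by rewrite inE => /orP[/eqP->|/hx].
Qed.

Section Core.
Variables m n : nat.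
Implicit Types (a b s x y : 'M[int]_(m, n)) (u v w : seq 'M[int]_(m, n)).

Definition matkey a : seq int := [seq a e.1 e.2 | e <- enum {: 'I_m * 'I_n}].

Definition ltm a b : bool := lexlt (matkey a) (matkey b).

Lemma matkey_inj : injective matkey.
Proof.
move=> a b /eq_in_map h; apply/matrixP=> i j.
by apply: (h (i, j)); rewrite mem_enum.
Qed.

Lemma ltm_irr : irreflexive ltm.
Proof. by move=> a; apply: ltxx. Qed.

Lemma ltm_trans : transitive ltm.
Proof. by move=> b a c; apply: lt_trans. Qed.

Lemma ltm_total a b : a != b -> ltm a b || ltm b a.
Proof.
rewrite /ltm /lexlt => h.
have : (matkey a : seqlexi int) != matkey b by apply: contra_neq h =>
  /matkey_inj.
exact: lt_total.
Qed.

Lemma ltm_translate a b c : ltm (a + c) (b + c) = ltm a b.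
Proof.
rewrite /ltm /matkey -[RHS](lexlt_translate _ _ _ (fun e => c e.1 e.2)).
by congr lexlt; apply: eq_map => e; rewrite add_mxE.
Qed.

Lemma ltm_le_trans x y z : ltm x y -> ~~ ltm z y -> ltm x z.
Proof.
move=> h1 h2; case: (eqVneq y z) => [<- //|/ltm_total]; rewrite (negPf h2) orbF.
exact: ltm_trans.
Qed.

Definition entries i j w : seq int := [seq b i j | b <- w].

Lemma sum_entries i j w :
  \sum_(x <- entries i j w) x = (\sum_(a <- w) a) i j.
Proof. by rewrite big_map summxE. Qed.

Lemma weight_entries w :
  weight w = \sum_e \sum_(x <- entries e.1 e.2 w) x ^+ 2.
Proof.
by rewrite /weight exchange_big /=; apply: eq_bigr => e _; rewrite big_map.
Qed.

(* For balanced [w]: [s] lies in the smallest face of the subdivision of space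
   into unit cubes that contains all members of [w]. *)
Definition fits s w : Prop := forall i j, s i j \in entries i j w.

Lemma fitsP s w : fits s w <-> forall i j,
  exists2 b : 'M[int]_(m, n), b \in w & b i j = s i j.
Proof.
split=> h i j; first by have /mapP[b bw ->] := h i j; exists b.
by apply/mapP; have [b bw <-] := h i j; exists b.
Qed.

Lemma balanced_entries i j w : balanced w ->
  forall p q, p \in entries i j w -> q \in entries i j w -> p <= q + 1.
Proof.
by move=> /balancedP h p q /mapP[a aw ->] /mapP[b bw ->]; apply: h.
Qed.

(** Apply [sum_sq_balanced] at each position. In this way the weight detects the cell: a family with
    the same size and sum ties with [w] exactly when its members fit [w]. *)
Lemma balanced_weight w w' : balanced w -> size w = size w' ->
    \sum_(a <- w) a = \sum_(a <- w') a ->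
  [/\ weight w <= weight w',
      weight w' <= weight w -> forall x, x \in w' -> fits x w
    & (forall x, x \in w' -> fits x w) -> weight w' = weight w].
Proof.
move=> bw hs hS.
have hsz i j : size (entries i j w) = size (entries i j w').
  by rewrite /entries !size_map.
have hsum i j : \sum_(x <- entries i j w) x = \sum_(x <- entries i j w') x.
  by rewrite !sum_entries hS.
have H i j := sum_sq_balanced (hsz i j) (hsum i j) (balanced_entries bw).
rewrite !weight_entries; split.
- by apply: ler_sum => e _; case: (H e.1 e.2).
- move=> hle x xw i j; case: (H i j) => h1 h2 _; apply: h2; last exact: map_f.
  rewrite leNgt; apply/negP=> hlt; move: hle; apply/negP; rewrite -ltNge.
  rewrite (bigD1 (i, j)) //= [ltRHS](bigD1 (i, j)) //= ltr_leD //.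
  by apply: ler_sum => e _; case: (H e.1 e.2).
- move=> hf; apply: eq_bigr => e _; case: (H e.1 e.2) => _ _; apply.
  by move=> _ /mapP[a /hf/(_ e.1 e.2) ha ->].
Qed.

(* Balance the family [w1 + w2 - s, w3, ..., wd], whose first matrix may have
   negative entries: at each position the result has the sum of the members of
   [w] other than one agreeing with [s] there, so its entries occur in [w]. *)
Lemma complete_fit w s mu : balanced w -> (1 < size w)%N ->
    (forall a, a \in w -> margins a = mu) -> margins s = mu -> fits s w ->
  exists v, [/\ size (s :: v) = size w,
    \sum_(a <- s :: v) a = \sum_(a <- w) a,
    forall a, a \in v -> margins a = mu,
    forall a, a \in v -> fits a w & weight (s :: v) = weight w].
Proof.
move=> bw w1 mw ms sw.
have [v [v1 v2 v3 v4]] : exists v, [/\ (size v).+1 = size w,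
    \sum_(a <- v) a = \sum_(a <- w) a - s,
    forall a, a \in v -> margins a = mu & balanced v].
  case: w w1 mw {bw sw} => [|x1 [|x2 w]] // _ mw.
  have [|v [h1 h2 h3 h4]] := @exists_balanced m n ((x1 + x2 - s) :: w) mu.
    move=> a; rewrite inE => /orP[/eqP->|aw].
      by rewrite raddfB raddfD /= ms !mw ?addrK // !inE eqxx ?orbT.
    by apply: mw; rewrite !inE aw !orbT.
  exists v; split=> //=; first by rewrite h1.
  by rewrite h2 !big_cons [in RHS]addrA [LHS]addrAC.
have vfit a : a \in v -> fits a w.
  move=> av i j; have /mapP[b bw' sb] := sw i j.
  have hp := perm_to_rem bw'.
  have hs : size v = size (rem b w).
    by apply: succn_inj; rewrite v1 (perm_size hp).
  have bt : balanced (rem b w).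
    apply/balancedP => x y xr yr; apply: (balancedP w bw);
      [exact: mem_rem xr|exact: mem_rem yr].
  have hS : \sum_(x <- entries i j (rem b w)) x = \sum_(x <- entries i j v) x.
    rewrite !sum_entries v2 (sum_perm hp) big_cons sub_mxE add_mxE -sb.
    by rewrite addrAC subrr add0r.
  have hsz : size (entries i j (rem b w)) = size (entries i j v).
    by rewrite /entries !size_map.
  (* Both families are balanced, so each sum of squares is at most the other; equality puts the
     entries of [v] among those of [rem b w]. *)
  have [_ h _] := @sum_sq_balanced (entries i j (rem b w)) (entries i j v)
     hsz hS (balanced_entries bt).
  have [h' _ _] := @sum_sq_balanced (entries i j v) (entries i j (rem b w))
     (esym hsz) (esym hS) (balanced_entries v4).
  have /mapP[c cr ->] := h h' _ (map_f (fun a => a i j) av).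
  exact: (map_f (fun a => a i j) (mem_rem cr)).
have hS : \sum_(a <- w) a = \sum_(a <- s :: v) a.
  by rewrite big_cons v2 addrC subrK.
have hs : size w = size (s :: v) by rewrite -v1.
exists v; split=> //.
have [_ _] := balanced_weight bw hs hS; apply.
by move=> x; rewrite inE => /orP[/eqP->|/vfit].
Qed.

Lemma exists_neq0 x : x != 0 -> exists i j, x i j != 0.
Proof.
move=> x0; case: (pickP (fun q => x q.1 q.2 != 0)) => [q hq|h].
  by exists q.1, q.2.
by case/eqP: x0; apply/matrixP=> i j; rewrite mxE; have /negbFE/eqP := h (i, j).
Qed.

Lemma circulation_dim x i j : margins x = 0 -> x i j != 0 ->
  (2 <= m)%N /\ (2 <= n)%N.
Proof.
move=> mx hij; split.
  have [i1 h1] := sum0_pos (circ_col j mx) hij.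
  have [i2 h2] := sum0_neg (circ_col j mx) hij.
  have : i1 != i2 by apply: contraTneq h1 => ->; rewrite -leNgt ltW.
  rewrite -val_eqE /=; have := ltn_ord i1; have := ltn_ord i2; lia.
have [i1 h1] := sum0_pos (circ_row i mx) hij.
have [i2 h2] := sum0_neg (circ_row i mx) hij.
have : i1 != i2 by apply: contraTneq h1 => ->; rewrite -leNgt ltW.
rewrite -val_eqE /=; have := ltn_ord i1; have := ltn_ord i2; lia.
Qed.

(* The term order on monomials of equal degree without common variable. *)
Definition lower v w : Prop := weight v < weight w \/
  (weight v = weight w /\ exists2 x, x \in v & forall y, y \in w -> ltm x y).

Variable mu : 'cV[int]_m * 'rV[int]_n.

Definition point a : Prop := margins a = mu /\ forall i j, 0 <= a i j.

Definition reduces v w : Prop :=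
  [/\ size v = size w, \sum_(a <- v) a = \sum_(a <- w) a,
      forall x, x \in v -> point x & lower v w].

(** Standard monomials give irreducible families, since [lower] suffices for a smaller monomial even
    when variables are shared. *)
Definition irreducible w : Prop := forall v, ~ reduces v w.

(** Otherwise [exchange_pair] yields two points with the same sum and smaller weight. *)
Lemma irreducible_pair a b : point a -> point b -> irreducible [:: a; b] ->
  forall i j, a i j <= b i j + 1.
Proof.
move=> [ma pa] [mb pb] irr i j; rewrite leNgt; apply/negP=> hlt.
have [|a' [b' [h1 h2 h3 h4 h5]]] := exchange_pair _ hlt; first by rewrite ma mb.
apply: (irr [:: a'; b']); split=> //.
- by rewrite !big_cons !big_nil !addr0 h1.
- move=> x hx; split; last first.
    by move=> k l; case: (h5 x hx k l); apply: le_trans.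
  by move: hx; rewrite !inE => /orP[]/eqP->; rewrite ?h2 ?h3.
- by left; rewrite !weight_cons /weight !big_nil !addr0.
Qed.

Lemma fits_point s w : (forall x, x \in w -> point x) -> margins s = mu ->
  fits s w -> point s.
Proof.
move=> pw ms /fitsP fs; split=> // i j; have [b bw <-] := fs i j.
by case: (pw b bw).
Qed.

(** [complete_fit] extends [s] to a family with the size, sum and weight of [w]; if [s] preceded all
    of [w], that family would be lower. *)
Lemma irreducible_not_fit s w : irreducible w -> balanced w ->
    (1 < size w)%N -> (forall x, x \in w -> point x) -> margins s = mu ->
    fits s w ->
  ~ (forall y, y \in w -> ltm s y).
Proof.
move=> irr bw w1 pw ms fs hlt.
have mw a : a \in w -> margins a = mu by case/pw.
have [v [h1 h2 h3 h4 h5]] := complete_fit bw w1 mw ms fs.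
apply: (irr (s :: v)); split=> // [x|].
  by rewrite inE => /orP[/eqP->|xv]; apply: (fits_point pw) => //; auto.
by right; split=> //; exists s => //; rewrite inE eqxx.
Qed.

Section MinimalReducible.
Variables (d : nat) (a : 'I_d -> 'M[int]_(m, n)) (v : seq 'M[int]_(m, n)).

(** Indexing by ['I_d] lets [private] tell members apart before [minimal_reducible_inj] excludes
    repetitions. *)
Let u := [seq a l | l <- enum 'I_d].
Let others l := [seq a l' | l' <- rem l (enum 'I_d)].

Hypothesis d3 : (2 < d)%N.
Hypothesis pu : forall l, point (a l).
Hypothesis proper_irr : forall t w,
  perm_eq u (t ++ w) -> t != [::] -> irreducible w.
Hypothesis redv : reduces v u.
Hypothesis irrv : irreducible v.

Lemma mem_family l : a l \in u.
Proof. by apply: map_f; rewrite mem_enum. Qed.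

Lemma point_family x : x \in u -> point x.
Proof. by case/mapP=> l _ ->. Qed.

Lemma size_family : size u = d.
Proof. by rewrite size_map size_enum_ord. Qed.

Lemma perm_others l : perm_eq u (a l :: others l).
Proof.
by rewrite -map_cons; apply: perm_map; apply: perm_to_rem; rewrite mem_enum.
Qed.

Lemma mem_others l x : x \in others l <-> exists2 l', l' != l & x = a l'.
Proof.
split=> [/mapP[l']|[l' ne ->]].
  by rewrite mem_rem_uniq ?enum_uniq // !inE => /andP[ne _] ->; exists l'.
by apply: map_f; rewrite mem_rem_uniq ?enum_uniq // !inE ne mem_enum.
Qed.

Lemma others_irr l : irreducible (others l).
Proof. by apply: (@proper_irr [:: a l]) => //; apply: perm_others. Qed.

Lemma size_others l : (1 < size (others l))%N.
Proof. by have := perm_size (perm_others l); rewrite size_family /=; lia. Qed.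

(** As [d > 2], any two members form a proper subfamily, which is irreducible. *)
Lemma balanced_family : balanced u.
Proof.
apply/balancedP=> x y xu yu i j; case: (eqVneq y x) => [->|ne]; first by lia.
have hp : perm_eq u [:: x, y & rem y (rem x u)].
  by rewrite (perm_trans (perm_to_rem xu)) // perm_cons perm_to_rem // rem_mem.
apply: irreducible_pair => //; try exact: point_family.
apply: (@proper_irr (rem y (rem x u))).
  by rewrite (perm_trans hp) // perm_sym perm_catC.
by rewrite -size_eq0; have := perm_size hp; rewrite size_family /=; lia.
Qed.

Lemma balanced_others l : balanced (others l).
Proof.
apply/balancedP=> x y /mem_others[k _ ->] /mem_others[k' _ ->].
by apply: (balancedP _ balanced_family); apply: mem_family.
Qed.

Lemma point_others l x : x \in others l -> point x.
Proof. by case/mem_others=> k _ ->. Qed.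

(** The balanced [u] has least weight, so [v] is lower only by the tie-break and its members fit
    [u]. Take for [s] the first member of [v]: an earlier fit could be completed to a family
    reducing [v]. *)
Lemma exists_smaller_fit : exists s, [/\ margins s = mu, fits s u,
  forall l, ltm s (a l)
  & forall s', margins s' = mu -> fits s' u -> ~~ ltm s' s].
Proof.
have [v1 v2 v3 v4] := redv.
have [h1 h2 _] := balanced_weight balanced_family (esym v1) (esym v2).
case: v4 => [|[v4 [x xv hx]]]; first by rewrite ltNge h1.
have vfit := h2 (eq_ind_r (fun z => z <= _) (lexx _) v4).
have v0 : v != [::] by apply: contraTneq xv => ->.
have [s sv smin] := exists_minimal ltm_irr ltm_trans v0.
exists s; split.
- by case: (v3 s sv).
- exact: vfit.
- move=> l; have hxl := hx _ (mem_family l).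
  case: (eqVneq s x) => [->//|/ltm_total]; rewrite (negPf (smin x xv)) orbF.
  by move/ltm_trans; apply.
- move=> s' ms' fs'; apply/negP=> lt.
  have mw b : b \in u -> margins b = mu by case/point_family.
  have [|t [t1 t2 t3 t4 t5]] := complete_fit balanced_family _ mw ms' fs'.
    by rewrite size_family; lia.
  apply: (@irrv (s' :: t)); split.
  + by rewrite t1 v1.
  + by rewrite t2 v2.
  + by move=> y; rewrite inE => /orP[/eqP->|yt];
      apply: (fits_point point_family) => //; auto.
  + right; split; first by rewrite t5 v4.
    by exists s' => [|y yv]; [rewrite inE eqxx|exact: ltm_le_trans (smin y yv)].
Qed.

Definition private s l (e : 'I_m * 'I_n) : bool :=
  (a l e.1 e.2 == s e.1 e.2) &&
  [forall l', (l' != l) ==> (a l' e.1 e.2 != s e.1 e.2)].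

Lemma fits_others x l : (forall i j, exists2 l', l' != l & a l' i j = x i j) ->
  fits x (others l).
Proof.
move=> h; apply/fitsP=> i j; have [l' ne e] := h i j.
by exists (a l') => //; apply/mem_others; exists l'.
Qed.

Lemma not_private s l e : fits s u -> ~~ private s l e ->
  exists2 l', l' != l & a l' e.1 e.2 = s e.1 e.2.
Proof.
move=> fs; rewrite negb_and => /orP[h|].
  have [_ /mapP[l' _ ->] e'] := (fitsP _ _).1 fs e.1 e.2.
  by exists l' => //; apply: contraNneq h => <-; apply/eqP.
by case/forallPn=> l'; rewrite negb_imply negbK => /andP[ne /eqP e']; exists l'.
Qed.

(** Without a private entry of [l], the matrix [s] would fit the other members, all of which it
    precedes. *)
Lemma exists_private s : margins s = mu -> fits s u ->
  (forall l, ltm s (a l)) -> forall l, exists e, private s l e.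
Proof.
move=> ms fs hs l; case: (pickP (private s l)) => [e he|h]; first by exists e.
case: (@irreducible_not_fit s (others l)) => //.
- exact: others_irr.
- exact: balanced_others.
- exact: size_others.
- by move=> x; apply: point_others.
- by apply: fits_others => i j; apply: (@not_private s l (i, j)); rewrite ?h.
- by move=> y /mem_others[k _ ->].
Qed.

Lemma private_fun_inj s (D : {set 'I_d}) (e : 'I_d -> 'I_m * 'I_n) :
  (forall l, l \in D -> private s l (e l)) -> {in D &, injective e}.
Proof.
move=> h l l' lD l'D he; apply/eqP/negPn/negP=> ne.
have /andP[_ /forallP/(_ l)/implyP/(_ ne)] := h _ l'D.
by rewrite -he; have /andP[-> _] := h _ lD.
Qed.

(** Equal members agree everywhere, so neither could have a private entry. *)
Lemma minimal_reducible_inj : injective a.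
Proof.
have [s [ms fs ls _]] := exists_smaller_fit.
move=> l l' e; apply/eqP/negPn/negP=> ne.
have [q /andP[/eqP h1 /forallP/(_ l')/implyP]] := exists_private ms fs ls l.
by rewrite eq_sym ne -e h1 eqxx => /(_ isT).
Qed.

Lemma minimal_reducible_bound : (d <= (m * n)./2)%N.
Proof.
have [s [ms fs ls smin]] := exists_smaller_fit.
have bal l l' i j : a l i j <= a l' i j + 1.
  by apply: (balancedP _ balanced_family); apply: mem_family.
have bals l i j : -1 <= a l i j - s i j <= 1.
  have [b /mapP[l' _ ->] e'] := (fitsP _ _).1 fs i j.
  by rewrite -e'; have := bal l l' i j; have := bal l' l i j; lia.
have ma l : margins (a l) = mu by case: (pu l).
case: (leqP n 4) => [n4|n5].
  have hex l : exists e, private s l e by apply: exists_private.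
  pose e l := xchoose (hex l).
  have eP l : private s l (e l) := xchooseP (hex l).
  apply: (@private_entries_bound m n d (fun l => a l - s) e) => //.
  - by move=> l; rewrite raddfB /= ma ms subrr.
  - by move=> l l' i j /=; rewrite !sub_mxE; have := bal l l' i j; lia.
  - by move=> l i j /=; rewrite sub_mxE.
  - by move=> l /=; rewrite sub_mxE; have /andP[/eqP-> _] := eP l;
      rewrite subrr.
  - move=> l l' ne /=; rewrite sub_mxE subr_eq0.
    by have /andP[_ /forallP/(_ l')/implyP/(_ ne)] := eP l.
have [l1 l1min] : exists l1, forall l, ~~ ltm (a l) (a l1).
  have u0 : u != [::] by rewrite -size_eq0 size_family; lia.
  have [x /mapP[l1 _ ->] h] := exists_minimal ltm_irr ltm_trans u0.
  by exists l1 => l; apply: h; apply: mem_family.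
have y0 : a l1 - s != 0.
  by rewrite subr_eq0; apply: contraTneq (ls l1) => ->; rewrite ltm_irr.
have my : margins (a l1 - s) = 0 by rewrite raddfB /= ma ms subrr.
have [Z [mZ Z0 cZ rZ]] := conformal_cycle my y0.
(* The entries of [a l1 - s] are at most 1 in absolute value, so [Z] agrees with it on its
   support. *)
have ZE i j : Z i j != 0 -> Z i j = a l1 i j - s i j.
  move=> h; have := bals l1 i j; have := cZ i j; rewrite sub_mxE.
  by case=> [e|[-> ?]|[-> ?]]; [rewrite e eqxx in h|lia|lia].
(* [s + Z] agrees with [a l1] on the support of [Z] and with [s] elsewhere, so it fits [u], and [s]
   is the first fit. *)
have sZ : ltm s (s + Z).
  have ne : s != s + Z by rewrite -subr_eq0 opprD addNKr oppr_eq0.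
  case/orP: (ltm_total ne) => // lt.
  suff : ~~ ltm (s + Z) s by rewrite lt.
  apply: smin; first by rewrite raddfD /= ms mZ addr0.
  apply/fitsP=> i j; rewrite add_mxE; case: (eqVneq (Z i j) 0) => [->|h].
    by rewrite addr0; apply: (fitsP _ _).1.
  by exists (a l1); [exact: mem_family|rewrite ZE // addrC subrK].
(* Translate [sZ] by [a l1 - Z - s]. *)
have aZ : ltm (a l1 - Z) (a l1).
  have e : s + (a l1 - Z - s) = a l1 - Z by rewrite addrC subrK.
  move: sZ; rewrite -(ltm_translate s _ (a l1 - Z - s)) e [s + Z]addrC -addrA e.
  by rewrite [Z + _]addrC subrK.
have hex l : l != l1 -> exists e, private s l e && (Z e.1 e.2 != 0).
  move=> ne; case: (pickP (fun e => private s l e && (Z e.1 e.2 != 0))).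
    by move=> e he; exists e.
  move=> h; case: (@irreducible_not_fit (a l1 - Z) (others l)).
  - exact: others_irr.
  - exact: balanced_others.
  - exact: size_others.
  - by move=> x; apply: point_others.
  - by rewrite raddfB /= ma mZ subr0.
  (* Off the support of [Z] the member [a l1] serves; on it [a l1 - Z] equals [s], and the position
     is not private to [l]. *)
  - apply: fits_others => i j; rewrite sub_mxE.
    case: (eqVneq (Z i j) 0) => [->|Zij].
      by exists l1; rewrite ?subr0 // eq_sym.
    rewrite ZE // subKr; apply: (@not_private s l (i, j) fs).
    by have := h (i, j); rewrite Zij andbT => ->.
  - move=> y /mem_others[k _ ->]; exact: ltm_le_trans (l1min k).
(* Makes the choice of entries total; the value at [l1] is arbitrary. *)
have hex' l : exists e, (l != l1) ==> private s l e && (Z e.1 e.2 != 0).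
  case: (eqVneq l l1) => [->|/hex[e he]]; last by exists e.
  have [e _] := exists_private ms fs ls l1; by exists e.
pose e l := xchoose (hex' l).
have eP l : (l != l1) ==> private s l (e l) && (Z (e l).1 (e l).2 != 0)
  := xchooseP (hex' l).
have d1 : (d.-1 <= #|[set q : 'I_m * 'I_n | Z q.1 q.2 != 0%R]|)%N.
  have <- : #|[set~ l1]| = d.-1 by rewrite cardsC1 card_ord.
  rewrite -(@card_in_imset _ _ e); last first.
    apply: (@private_fun_inj s) => l; rewrite !inE => ne.
    by have /implyP/(_ ne)/andP[] := eP l.
  apply/subset_leq_card/subsetP=> _ /imsetP[l hl ->]; rewrite !inE in hl *.
  by have /implyP/(_ hl)/andP[] := eP l.
have hZ : (#|[set q : 'I_m * 'I_n | Z q.1 q.2 != 0%R]| <= m * 2)%N.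
  rewrite -sum1_card (partition_big (fun q => q.1) predT) //=.
  rewrite -[X in (_ <= X * _)%N](card_ord m) -sum_nat_const leq_sum // => i _.
  apply: leq_trans (rZ i); rewrite sum1_card.
  have <- : #|[set (i, j) | j in [set j | Z i j != 0]]|
      = #|[set j | Z i j != 0]|.
    by apply: card_in_imset => j j' _ _ [].
  apply/subset_leq_card/subsetP=> -[i' j]; rewrite unfold_in /= inE /= =>
    /andP[hij /eqP ii'].
  by rewrite -ii'; apply: imset_f; rewrite inE.
have [i [j hij]] := exists_neq0 Z0.
have [m2 _] := circulation_dim mZ hij.
(* From [d - 1 <= 2 m] and [m >= 2] follows [2 d <= 4 m + 2 <= 5 m]. *)
have : (m * 5 <= m * n)%N by rewrite leq_mul2l n5 orbT.
lia.
Qed.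

End MinimalReducible.

Theorem minimal_reducible u v :
    (forall x, x \in u -> point x) ->
    (forall t w, perm_eq u (t ++ w) -> t != [::] -> irreducible w) ->
    reduces v u -> irreducible v ->
  uniq u /\ (size u <= (m * n)./2)%N.
Proof.
move=> pu irr red irrv.
case: (ltnP 2 (size u)) => hd.
  pose a (l : 'I_(size u)) := nth 0 u l.
  have eu : u = [seq a l | l <- enum 'I_(size u)].
    apply: (@eq_from_nth _ 0); first by rewrite size_map size_enum_ord.
    by move=> i hi; rewrite (nth_map (Ordinal hi)) ?size_enum_ord // /a
      nth_enum_ord.
  have pa l : point (a l) by apply: pu; apply: mem_nth.
  split; last by apply: (@minimal_reducible_bound _ a v) => //; rewrite -eu.
  rewrite eu map_inj_uniq ?enum_uniq //.
  by apply: (@minimal_reducible_inj _ a v) => //; rewrite -eu.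
(* Degrees at most 2 are treated directly; a single point is determined by its sum, so it cannot be
   reduced. *)
case: red => v1 v2 pv lo.
case: u v1 v2 pu irr lo hd => [|x [|y [|]]] // v1 v2 pu irr lo _.
- clear pv irrv; case: v v1 v2 lo => [|x' [|x2 v]] //= _.
  rewrite !big_cons !big_nil !addr0 => -> [|[_ [z]]]; first by rewrite ltxx.
  by rewrite inE => /eqP-> /(_ x); rewrite inE eqxx ltm_irr => /(_ isT).
(* A repeated point cannot be reduced: every member of [v] would fit [[:: x; x]] and hence equal
   [x]. *)
have xy : x != y.
  apply/eqP=> e; rewrite -e in v1 v2 lo.
  have bx : balanced [:: x; x].
    apply/balancedP=> a b; rewrite !inE !orbb => /eqP-> /eqP->; lia.
  have [h1 h2 _] := balanced_weight bx (esym v1) (esym v2).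
  case: lo => [|[hw [z zv hz]]]; first by rewrite ltNge h1.
  have fz := (fitsP _ _).1 (h2 (eq_ind_r (fun z => z <= _) (lexx _) hw) z zv).
  have zx : z = x.
    by apply/matrixP=> i j; have [b] := fz i j; rewrite !inE orbb => /eqP->.
  by have := hz x; rewrite zx ltm_irr inE eqxx => /(_ isT).
split; first by rewrite /= inE xy.
have my : margins (x - y) = 0.
  have [mx _] : point x by apply: pu; rewrite !inE eqxx.
  have [my _] : point y by apply: pu; rewrite !inE eqxx orbT.
  by rewrite raddfB /= mx my subrr.
(* A nonzero circulation needs two rows and two columns, so 2 is within the bound. *)
have xy0 : x - y != 0 by rewrite subr_eq0.
have [i [j hij]] := exists_neq0 xy0.
have [m2 n2] := circulation_dim my hij.
have : (2 * 2 <= m * n)%N by apply: leq_mul.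
rewrite /=; lia.
Qed.

End Core.

(** * The term order *)

Section MonomialsAsSequences.
Variables (I : choiceType) (pts : seq I).
Hypotheses (pts_uniq : uniq pts) (pts_all : forall x, x \in pts).
Implicit Types (u v w : {cmonom I}) (s t : seq I).

Definition mon s : {cmonom I} := \big[mmul/mone]_(x <- s) ucm x.

Definition items u : seq I := flatten [seq nseq (u x) x | x <- pts].

Lemma monE s x : mon s x = count_mem x s.
Proof.
elim: s => [|y s IH]; first by rewrite /mon big_nil cm1.
by rewrite /mon big_cons cmM cmU -/(mon s) IH.
Qed.

Lemma count_items u x : count_mem x (items u) = u x.
Proof.
rewrite /items count_flatten -map_comp sumnE big_map.
rewrite (bigD1_seq x) //= count_nseq /= eqxx mul1n big1 ?addn0 // => y hy.
by rewrite count_nseq /= (negPf hy).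
Qed.

Lemma mem_items u x : (x \in items u) = (0 < u x)%N.
Proof. by rewrite -count_items -has_count has_pred1. Qed.

Lemma items_mon s : perm_eq (items (mon s)) s.
Proof. by apply/allP => x _ /=; rewrite count_items monE. Qed.

Lemma mon_items u : mon (items u) = u.
Proof. by apply/eqP/cmP => x; rewrite monE count_items. Qed.

Lemma itemsM u v : perm_eq (items (mmul u v)) (items u ++ items v).
Proof. by apply/allP => x _ /=; rewrite count_cat !count_items cmM. Qed.

Lemma mon_cat s t : mon (s ++ t) = mmul (mon s) (mon t).
Proof. by apply/eqP/cmP => x; rewrite cmM !monE count_cat. Qed.

Lemma mon_perm s t : perm_eq s t -> mon s = mon t.
Proof. by move=> /permP h; apply/eqP/cmP => x; rewrite !monE h. Qed.

Lemma mdeg_mon s : mdeg (mon s) = size s.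
Proof.
by rewrite /mon mdeg_prod (eq_bigr (fun=> 1%N)) ?sum1_size // => x _;
  rewrite mdegU.
Qed.

Lemma size_items u : size (items u) = mdeg u.
Proof. by rewrite -mdeg_mon mon_items. Qed.

Lemma ucm_factor u x : (0 < u x)%N -> exists v, u = mmul (ucm x) v.
Proof.
move=> h; exists (divcm u (ucm x)); apply/eqP/cmP => y.
by rewrite cmM divcmE cmU; case: eqP => [<-|_] /=; rewrite ?subnKC ?subn0.
Qed.

(** A finite list, possibly with repetitions, from which least elements of fibers and the elements
    of the basis are selected. *)
Fixpoint monomials d : seq {cmonom I} :=
  if d is d'.+1 then [seq mmul (ucm x) u | x <- pts, u <- monomials d']
  else [:: mone].

Lemma mem_monomials u : u \in monomials (mdeg u).
Proof.
have [d hd] : exists d, mdeg u = d by exists (mdeg u).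
rewrite hd; elim: d u hd => [|d IH] u hd.
  by rewrite inE (mdeg_eq0I hd).
case E : (items u) => [|x s]; first by have := size_items u; rewrite E hd.
have [v uv] : exists v, u = mmul (ucm x) v.
  by apply: ucm_factor; rewrite -mem_items E inE eqxx.
have hv : mdeg v = d by move: hd; rewrite uv mdegM mdegU => -[].
by rewrite uv; apply: allpairs_f => //; apply: IH.
Qed.

End MonomialsAsSequences.

Section OrderAndFibers.
Variables (m n : nat) (mu : 'cV[int]_m * 'rV[int]_n).
Variables (I : choiceType) (pts : seq I) (mat : I -> 'M[int]_(m, n)).
Hypotheses (pts_uniq : uniq pts) (pts_all : forall x, x \in pts).
Hypothesis pts_sorted : sorted (fun x y => ltm (mat x) (mat y)) pts.
Hypothesis mat_inj : injective mat.
Hypothesis mat_point : forall x, point mu (mat x).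
Hypothesis point_mat : forall a, point mu a -> exists x, mat x = a.
Implicit Types (u v w : {cmonom I}) (s t : seq I).
Local Notation items := (items pts).

Definition mats u := [seq mat x | x <- items u].

Definition expo u := \sum_(a <- mats u) a.

(** The exponents are negated because the monomial with more of the earliest distinguishing point is
    to be smaller. *)
Definition orderkey u : seq int :=
  [:: (mdeg u)%:Z, weight (mats u) & [seq - (u x)%:Z | x <- pts]].

Definition mlt u v : bool := lexlt (orderkey u) (orderkey v).

Definition mle u v : bool := ~~ mlt v u.

Lemma mats_mon s : perm_eq (mats (mon s)) [seq mat x | x <- s].
Proof. exact/perm_map/items_mon. Qed.

Lemma matsM u v : perm_eq (mats (mmul u v)) (mats u ++ mats v).
Proof. by rewrite -map_cat; apply/perm_map/itemsM. Qed.

Lemma expoM u v : expo (mmul u v) = expo u + expo v.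
Proof. by rewrite /expo (sum_perm (matsM u v)) big_cat. Qed.

Lemma weightM u v : weight (mats (mmul u v)) = weight (mats u) + weight (mats
  v).
Proof. by rewrite (weight_perm (matsM u v)) /weight big_cat. Qed.

Lemma size_mats u : size (mats u) = mdeg u.
Proof. by rewrite size_map size_items. Qed.

Lemma mats_point u a : a \in mats u -> point mu a.
Proof. by case/mapP=> x _ ->. Qed.

Lemma points_lift (w : seq 'M[int]_(m, n)) : (forall a, a \in w -> point mu a)
  ->
  exists s, [seq mat x | x <- s] = w.
Proof.
elim: w => [|a w IH] h; first by exists [::].
have [|s <-] := IH; first by move=> b bw; apply: h; rewrite inE bw orbT.
have [|x <-] := point_mat (_ : point mu a); first by apply: h; rewrite inE eqxx.
by exists (x :: s).
Qed.

Lemma orderkey_inj : injective orderkey.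
Proof.
move=> u v [_ _ /eq_in_map h]; apply/eqP/cmP => x.
by have /oppr_inj[] := h x (pts_all x).
Qed.

(** Every component of the key is additive under multiplication; [tags] names the components so that
    [lexlt_translate] applies. *)
Lemma mltM u v w : mlt (mmul u w) (mmul v w) = mlt u v.
Proof.
pose f u (i : option (option I)) : int := match i with
  | None => (mdeg u)%:Z | Some None => weight (mats u)
  | Some (Some x) => - (u x)%:Z end.
pose tags := [:: None, Some None & [seq Some (Some x) | x <- pts]].
have keyE z : orderkey z = [seq f z i | i <- tags].
  by rewrite /orderkey /= -map_comp.
have fM y z i : f (mmul y z) i = f y i + f z i.
  case: i => [[x|]|] /=; first by rewrite cmM PoszD opprD.
    exact: weightM.
  by rewrite mdegM PoszD.
rewrite /mlt !keyE -[RHS](lexlt_translate _ _ _ (f w)).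
by congr lexlt; apply: eq_map => i; rewrite fM.
Qed.

Lemma mlt_irr : irreflexive mlt.
Proof. by move=> u; apply: ltxx. Qed.

Lemma mlt_total u v : u != v -> mlt u v || mlt v u.
Proof.
move=> h; have : (orderkey u : seqlexi int) != orderkey v.
  by apply: contra_neq h => /orderkey_inj.
exact: lt_total.
Qed.

Lemma mlt_trans : transitive mlt.
Proof. by move=> v u w; apply: lt_trans. Qed.

Lemma mle_term_order : term_order mle.
Proof.
have leE u v : mle u v = ((orderkey u : seqlexi int) <= orderkey v)%O.
  by rewrite /mle /mlt /lexlt -leNgt.
split.
- by move=> u v; rewrite !leE le_total.
- by move=> u v; rewrite !leE => /le_anti/orderkey_inj.
- by move=> v u w; rewrite !leE; apply: le_trans.
- move=> u; case: (eqVneq u mone) => [->|u1]; first by rewrite leE.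
  have : (0 < mdeg u)%N by rewrite lt0n mdeg_eq0.
  rewrite /mle /mlt /orderkey lexlt_cons mdeg1 => h.
  have -> : (mdeg u)%:Z < 0 = false by lia.
  by have -> : ((mdeg u)%:Z == 0) = false by lia.
- by move=> u v w; rewrite /mle mltM.
Qed.

Lemma mat_ltm_trans : transitive (fun x y => ltm (mat x) (mat y)).
Proof. by move=> y x z; apply: ltm_trans. Qed.

(** [g] vanishes up to and including [x], so the first positive value of [f], found no later than
    [x], decides. *)
Lemma lexlt_of_smaller (f g : I -> nat) (p : seq I) x :
    sorted (fun x y => ltm (mat x) (mat y)) p -> x \in p ->
    (0 < f x)%N -> (forall y, (0 < g y)%N -> ltm (mat x) (mat y)) ->
  lexlt [seq - (f y)%:Z | y <- p] [seq - (g y)%:Z | y <- p].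
Proof.
move=> + + fx gx; elim: p => //= y p IH hs.
have /allP hy := order_path_min mat_ltm_trans hs.
rewrite inE lexlt_cons => xp.
have gy : g y = 0%N.
  apply/eqP; rewrite -leqn0 leqNgt; apply/negP=> /gx.
  case/orP: xp => [/eqP->|/hy h1 h2]; first by rewrite ltm_irr.
  by have := ltm_trans h1 h2; rewrite ltm_irr.
rewrite gy; case: (eqVneq (f y) 0%N) => [fy|fy].
  rewrite fy eqxx ltxx /=; apply: IH; first exact: path_sorted hs.
  by case/orP: xp => // /eqP xy; move: fx; rewrite xy fy.
by rewrite (_ : - (f y)%:Z < _ = true) //; lia.
Qed.

(** With disjoint supports, equal values are zero; so both functions vanish before the first
    difference, where [f] is positive and [g] is zero. *)
Lemma smaller_of_lexlt (f g : I -> nat) (p : seq I) :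
    sorted (fun x y => ltm (mat x) (mat y)) p ->
    (forall x, f x = 0%N \/ g x = 0%N) ->
    lexlt [seq - (f y)%:Z | y <- p] [seq - (g y)%:Z | y <- p] ->
  exists2 x, (0 < f x)%N & forall y, y \in p -> (0 < g y)%N ->
    ltm (mat x) (mat y).
Proof.
move=> + fg; elim: p => //= y p IH hs.
have /allP hy := order_path_min mat_ltm_trans hs.
rewrite lexlt_cons => /orP[lt|/andP[/eqP e /(IH (path_sorted hs))[x fx hx]]].
  have fy : (0 < f y)%N by lia.
  have gy : g y = 0%N by case: (fg y) => // e; rewrite e in fy.
  exists y => // z; rewrite inE => /orP[/eqP->|/hy//].
  by rewrite gy.
have gy : g y = 0%N by case: (fg y) => // h; move: e; rewrite h; lia.
exists x => // z; rewrite inE => /orP[/eqP->|]; first by rewrite gy.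
exact: hx.
Qed.

Lemma mlt_of_lower s t : size s = size t ->
  lower [seq mat x | x <- s] [seq mat x | x <- t] -> mlt (mon s) (mon t).
Proof.
move=> hst; rewrite /lower -(weight_perm (mats_mon s)) -(weight_perm (mats_mon
  t)).
rewrite /mlt !lexlt_cons !mdeg_mon hst eqxx ltxx /=.
case=> [->//|[-> [_ /mapP[x xs ->] hx]]]; rewrite eqxx ltxx /=.
apply: (@lexlt_of_smaller _ _ _ x) => //.
  by rewrite monE -has_count has_pred1.
by move=> y; rewrite monE -has_count has_pred1 => yt; apply: hx; apply: map_f.
Qed.

Lemma lower_of_mlt u v : mdeg u = mdeg v -> mlt u v ->
  (forall x, u x = 0%N \/ v x = 0%N) -> lower (mats u) (mats v).
Proof.
move=> hd; rewrite /mlt !lexlt_cons hd eqxx ltxx /= => + uv.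
case/orP=> [h|/andP[/eqP h lt]]; [by left|right; split=> //].
have [x ux hx] := smaller_of_lexlt pts_sorted uv lt.
exists (mat x); first by apply: map_f; rewrite mem_items.
by move=> _ /mapP[y yv ->]; apply: hx => //; rewrite -(mem_items pts_uniq
  pts_all).
Qed.

(** These are the monomials of the initial ideal: [u] leads the toric binomial [u - v]. *)
Definition reducible u : Prop := exists2 v, expo v = expo u & mlt v u.

Hypothesis expo_mdeg : forall u v, expo u = expo v -> mdeg u = mdeg v.

Lemma reducibleM u w : reducible u -> reducible (mmul u w).
Proof.
by move=> [v e lt]; exists (mmul v w); rewrite ?mltM // !expoM e.
Qed.

Lemma irreducible_mats s :
  ~ reducible (mon s) -> irreducible mu [seq mat x | x <- s].
Proof.
move=> hs v [v1 v2 v3 v4]; have [t ht] := points_lift v3; apply: hs.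
exists (mon t); last by apply: mlt_of_lower; rewrite ?ht // -(size_map mat) ht
  v1 size_map.
by rewrite /expo !(sum_perm (mats_mon _)) ht.
Qed.

(** Fibers of [expo] have constant degree, hence are finite; take the least element. *)
Lemma exists_standard u :
  exists v, [/\ expo v = expo u, ~ reducible v & u = v \/ mlt v u].
Proof.
pose L := [seq v <- monomials pts (mdeg u) | expo v == expo u].
have LP v : expo v = expo u -> v \in L.
  by move=> e; rewrite mem_filter e eqxx -(expo_mdeg e); apply: mem_monomials.
have uL : u \in L by apply: LP.
have L0 : L != [::] by apply: contraTneq uL => ->.
have [v + hv] := exists_minimal mlt_irr mlt_trans L0.
rewrite mem_filter => /andP[/eqP e _].
exists v; split=> //.
- by move=> [w ew lt]; have := hv w (LP w (etrans ew e)); rewrite lt.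
- case: (eqVneq u v) => [->|/mlt_total b]; [by left|right].
  by move: b; rewrite (negPf (hv u uL)).
Qed.

(** The minimal monomial generators of the initial ideal. *)
Definition min_reducible u : Prop :=
  reducible u /\ forall w v, u = mmul w v -> v != mone -> ~ reducible w.

Lemma min_reducible_bound u : min_reducible u ->
  squarefree_mon u /\ (mdeg u <= (m * n)./2)%N.
Proof.
move=> [[v0 e0 lt0] hmin].
have [v [e irr hv]] := exists_standard u.
have lt : mlt v u by case: hv => // uv; case: irr; exists v0; rewrite -?uv.
(* Cancelling a common variable would make a proper divisor of [u] reducible. *)
have dis x : v x = 0%N \/ u x = 0%N.
  case: (posnP (v x)) => [|hvx]; [by left|case: (posnP (u x)) => [|hux]].
    by right.
  have [u' hu] := ucm_factor hux; have [v' hv'] := ucm_factor hvx.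
  have /(_ u' (ucm x))[] := hmin; first by rewrite hu mulmC.
    by rewrite cm1_eq1.
  exists v'; last by move: lt; rewrite hu hv' ![mmul (ucm x) _]mulmC mltM.
  by apply: (addrI (expo (ucm x))); rewrite -!expoM -hu -hv'.
have matsE w : mats w = [seq mat x | x <- items w] by [].
have [||||hu hs] := @minimal_reducible m n mu (mats u) (mats v).
- by move=> x; apply: mats_point.
- move=> t w hp t0.
  have ht a : a \in t -> point mu a.
    by move=> h; apply: (@mats_point u); rewrite (perm_mem hp) mem_cat h.
  have hw a : a \in w -> point mu a.
    by move=> h; apply: (@mats_point u); rewrite (perm_mem hp) mem_cat h orbT.
  have [st et] := points_lift ht; have [sw ew] := points_lift hw.
  rewrite -ew; apply: irreducible_mats; apply: (hmin _ (mon st)).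
    rewrite -mon_cat -[LHS](mon_items pts_uniq pts_all); apply: mon_perm.
    apply: (perm_map_inj mat_inj); rewrite map_cat et ew.
    by rewrite perm_sym perm_catC perm_sym.
  by rewrite -mdeg_eq0 mdeg_mon size_eq0; apply: contra_neq t0 => st0;
     rewrite -et st0.
- split.
  + by rewrite !size_mats (expo_mdeg e).
  + exact: e.
  + by move=> x; apply: mats_point.
  + by apply: lower_of_mlt => //; apply: expo_mdeg.
- by rewrite matsE; apply: irreducible_mats; rewrite mon_items.
split; last by rewrite -size_mats.
move=> x; rewrite -(count_items pts_uniq pts_all) leqNgt; apply/negP=> h.
have : count_mem x (items u) = (x \in items u) by apply: count_uniq_mem;
  apply: map_uniq hu.
by case: (x \in items u) => h'; rewrite h' in h.
Qed.

Lemma exists_min_reducible u : reducible u ->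
  exists w v, min_reducible w /\ u = mmul w v.
Proof.
have [k] := ubnP (mdeg u).
elim: k u => // k IH u hk hu.
case: (boolp.pselect (exists w v, [/\ u = mmul w v, v != mone & reducible w])).
  move=> [w [t [e t1 hw]]].
  have [|w' [t' [h1 h2]]] := IH w _ hw.
    rewrite -ltnS; apply: leq_trans hk; rewrite e mdegM ltnS -[X in (X <
      _)%N]addn0 ltn_add2l.
    by rewrite lt0n mdeg_eq0.
  by exists w', (mmul t' t); rewrite e h2 mulmA.
move=> h; exists u, mone; split; last by rewrite mulm1.
by split=> // w t e t1 hw; apply: h; exists w, t.
Qed.

End OrderAndFibers.

(** * Reduced Groebner bases and the toric map *)

Section LeadingMonomials.
Variables (k : fieldType) (I : choiceType) (le : rel {cmonom I}).
Hypothesis le_order : term_order le.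
Implicit Types (u v w : {cmonom I}) (f g : {malg k[{cmonom I}]}).

Lemma bigmax_mon (s : seq {cmonom I}) :
  let M := \big[(fun u v => if le u v then v else u)/mone]_(u <- s) u in
  (forall u, u \in s -> le u M) /\ (s != [::] -> M \in s).
Proof.
have [tot anti tr le1 _] := le_order.
elim: s => [|x s [IH1 IH2]] /=; first by split.
rewrite big_cons; set M := bigop.body _ _ _ in IH1 IH2 *.
case: ifP => h; split.
- by move=> u; rewrite inE => /orP[/eqP->|/IH1].
(* For a singleton the comparison is with the default [mone], and [le x mone] forces [x = mone]. *)
- move=> _; case: (eqVneq s [::]) => [s0|/IH2 hs]; last by rewrite inE hs orbT.
  move: h; rewrite /M s0 big_nil => h.
  by rewrite (anti mone x) ?inE ?eqxx // h le1.
- move=> u; rewrite inE => /orP[/eqP->|/IH1 hu]; first by case/orP: (tot x x).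
  by apply: (tr _ _ _ hu); have := tot x M; rewrite h.
- by rewrite inE eqxx.
Qed.

Lemma lead_mon_ge f u : u \in msupp f -> le u (lead_mon le f).
Proof. exact: (bigmax_mon _).1. Qed.

Lemma lead_mon_mem f : f != 0 -> lead_mon le f \in msupp f.
Proof.
move=> f0; apply: (bigmax_mon _).2; apply: contra_neq f0 => h.
apply/eqP; rewrite -msupp_eq0; apply/eqP/fsetP=> x; rewrite in_fset0.
by have : (x \in enum_fset (msupp f)) = false by rewrite h.
Qed.

Definition binom u v : {malg k[{cmonom I}]} := << u >> - << v >>.

Lemma binom_coeff u v w : (binom u v)@_w = (u == w)%:R - (v == w)%:R.
Proof.
exact: etrans (mcoeffB _ _ _)
  (congr2 (fun a b => a - b) (mcoeffU1 _ u w) (mcoeffU1 _ v w)).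
Qed.

Lemma mem_msupp_binom u v w : u != v ->
  (w \in msupp (binom u v)) = (w == u) || (w == v).
Proof.
move=> ne; rewrite -mcoeff_neq0 binom_coeff ![w == _]eq_sym.
case: (eqVneq u w) => [uw|]; case: (eqVneq v w) => [vw|] /=.
- by rewrite uw vw eqxx in ne.
- by rewrite subr0 oner_eq0.
- by rewrite sub0r oppr_eq0 oner_eq0.
- by rewrite subrr eqxx.
Qed.

Lemma lead_mon_binom u v : u != v -> le v u -> lead_mon le (binom u v) = u.
Proof.
have [_ anti _ _ _] := le_order.
move=> ne h.
have uS : u \in msupp (binom u v) by rewrite mem_msupp_binom // eqxx.
have b0 : binom u v != 0 by apply: contraTneq uS => ->; rewrite msupp0.
have := lead_mon_mem b0; rewrite mem_msupp_binom // => /orP[/eqP//|/eqP e].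
by apply/esym/anti; rewrite {2}e h (lead_mon_ge uS).
Qed.

Lemma lead_coeff_binom u v : u != v -> le v u -> lead_coeff le (binom u v) = 1.
Proof.
move=> ne h; rewrite /lead_coeff lead_mon_binom // binom_coeff eqxx.
by rewrite eq_sym (negPf ne) subr0.
Qed.

End LeadingMonomials.

Section ReducedBasis.
Variables (k : fieldType) (I : choiceType) (le : rel {cmonom I}).
Local Notation poly := {malg k[{cmonom I}]}.
Hypothesis le_order : term_order le.
Implicit Types (u v w : {cmonom I}) (f g : poly).

Lemma ideal_gen_incl (S T : poly -> Prop) f :
  (forall g, S g -> ideal_gen T g) -> ideal_gen S f -> ideal_gen T f.
Proof.
move=> ST [s hs ->]; elim: s hs => [|[p q] s IH] hs.
  by exists [::] => //; rewrite !big_nil.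
have [|s1 h1 e1] := IH; first by move=> x xs; apply: hs; rewrite inE xs orbT.
have [s2 h2 e2] := ST _ (hs (p, q) (mem_head _ _)).
exists ([seq (p * x.1, x.2) | x <- s2] ++ s1).
  by move=> x; rewrite mem_cat => /orP[/mapP[y ys ->]|/h1//]; exact: (h2 _ ys).
rewrite big_cons big_cat e1 /= big_map; congr (_ + _).
rewrite [q]e2 big_distrr /=; apply: eq_bigr => x _; exact: mulrA.
Qed.

Lemma ideal_gen_mem (S : poly -> Prop) p g : S g -> ideal_gen S (p * g).
Proof.
by move=> h; exists [:: (p, g)] => [x|]; rewrite ?big_seq1 // inE => /eqP->.
Qed.

Variables (J : poly -> Prop) (red minred : {cmonom I} -> Prop).
Variables (std : {cmonom I} -> {cmonom I}) (L : seq {cmonom I}).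
Hypothesis lead_red : forall f, J f -> f != 0 -> red (lead_mon le f).
Hypothesis red_minred :
  forall u, red u -> exists w v, minred w /\ u = mmul w v.
Hypothesis redM : forall u v, red u -> red (mmul u v).
Hypothesis minred_red : forall u, minred u -> red u.
Hypothesis minred_min :
  forall w v, minred (mmul w v) -> v != mone -> ~ red w.
Hypothesis J_binom : forall u, minred u -> J (binom k u (std u)).
Hypothesis std_le : forall u, minred u -> le (std u) u.
Hypothesis std_irr : forall u, minred u -> ~ red (std u).
Hypothesis minred_L : forall u, minred u -> u \in L.

Lemma std_neq u : minred u -> u != std u.
Proof.
by move=> h; apply/eqP=> e; apply: (std_irr h); rewrite -e; apply: minred_red.
Qed.

Definition reduced_basis : {fset poly} :=
  [fset g in [seq binom k u (std u) | u <- L & boolp.asbool (minred u)]]%fset.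

Lemma mem_reduced_basis g : g \in reduced_basis <->
  exists2 u, minred u & g = binom k u (std u).
Proof.
rewrite inE /=; split.
  by case/mapP=> u; rewrite mem_filter => /andP[/boolp.asboolP h _] ->;
    exists u.
case=> u hu ->; apply/mapP; exists u => //.
by rewrite mem_filter minred_L // andbT; apply/boolp.asboolP.
Qed.

Lemma lead_term_binom u : minred u ->
  lead_term le (binom k u (std u)) = << u >>.
Proof.
move=> hu; rewrite /lead_term lead_coeff_binom ?lead_mon_binom //;
  by [apply: std_neq|apply: std_le].
Qed.

(** Leading monomials of [J] are multiples of minimal generators, which gives the Groebner property.
    It is reduced because no minimal generator divides a different one, nor a standard tail
    [std v]. *)
Lemma reduced_basisP : reduced_groebner_basis le J reduced_basis.
Proof.
split.
- split=> [g /mem_reduced_basis[u hu ->]|p]; first exact: J_binom.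
  split.
    apply: ideal_gen_incl => _ [g /mem_reduced_basis[u hu ->] ->].
    rewrite -[lead_term _ _]mul1r; apply: ideal_gen_mem.
    by exists (binom k u (std u)) => //; apply: J_binom.
  apply: ideal_gen_incl => _ [f hf ->].
  case: (eqVneq f 0) => [->|f0].
    exists [::] => //; rewrite big_nil /lead_term /lead_coeff mcoeff0.
    exact: monalgU0.
  have [w [v [hw e]]] := red_minred (lead_red hf f0).
  rewrite /lead_term e (_ : << _ *g _ >> = << lead_coeff le f *g v >> * << w
    >>).
    apply: ideal_gen_mem; exists (binom k w (std w)); last first.
      by rewrite -/(lead_term _ _) lead_term_binom.
    by apply/mem_reduced_basis; exists w.
  by rewrite malgM_def fgmulUU mulr1 mulmC.
- move=> g /mem_reduced_basis[u hu ->].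
  by apply: lead_coeff_binom => //; [apply: std_neq|apply: std_le].
move=> g h /mem_reduced_basis[u hu ->] /mem_reduced_basis[v hv ->] ne w.
rewrite lead_mon_binom ?(std_neq, std_le) //.
rewrite mem_msupp_binom ?std_neq // => /orP[/eqP->|/eqP->] [t e].
  case: (eqVneq t mone) => [t1|t1].
    by case/eqP: ne; rewrite e t1 mulm1.
  by apply: (minred_min _ t1 (minred_red hu)); rewrite -e.
by apply: (std_irr hv); rewrite e; apply: redM; apply: minred_red.
Qed.

End ReducedBasis.

Section ToricMap.
Variables (k : fieldType) (R : realType) (m n : nat) (P : pred 'M[R]_(m, n)).
Local Notation I := (lattice_point P).
Local Notation mon := {cmonom I}.
Local Notation poly := {malg k[mon]}.
Hypothesis nonneg : forall (x : I) i j, 0 <= val x i j.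
Implicit Types (u v : mon) (f : poly).

(** By [nonneg], [absz] loses nothing on lattice points, whose Laurent monomials are therefore
    ordinary ones. *)
Definition exponent (a : 'M[int]_(m, n)) : mpoly.multinom (m * n) :=
  mpoly.Multinom [tuple absz (mxvec a 0 l) | l < m * n].

Definition mon_exponent u : mpoly.multinom (m * n) :=
  \big[mpoly.mnm_add/mpoly.mnm0]_(x <- finsupp u)
    mpoly.mnm_muln (exponent (val x)) (u x).

Lemma laurent_monomialE (x : I) : laurent_monomial k (val x) =
  FracField.tofrac (mpoly.mpolyX k (exponent (val x))).
Proof.
rewrite mpoly.mpolyXE_id rmorph_prod /=.
rewrite (reindex _ (curry_mxvec_bij m n)) /=.
rewrite /laurent_monomial (pair_bigA _ (fun i j => ratfun_var k i j ^ val x i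
  j)).
apply: eq_bigr => -[i j] _ /=.
rewrite mpoly.mnmE mxvecE rmorphXn /= /ratfun_var.
by have := nonneg x i j; case: (val x i j).
Qed.

Lemma mon_image u : \prod_(a <- finsupp u) laurent_monomial k (val a) ^+ u a =
  FracField.tofrac (mpoly.mpolyX k (mon_exponent u)).
Proof.
rewrite (eq_bigr (fun x : I => FracField.tofrac
  (mpoly.mpolyX k (mpoly.mnm_muln (exponent (val x)) (u x))))).
  rewrite -rmorph_prod /=; congr FracField.tofrac.
  rewrite /mon_exponent.
  by elim/big_rec2: _ => [|x p q _ ->]; rewrite ?mpoly.mpolyX0 // mpoly.mpolyXD.
by move=> x _; rewrite laurent_monomialE -rmorphXn /= mpoly.mpolyXn.
Qed.

(** Compare the coefficients of each monomial of k[t] in the image; k[t] embeds in its fraction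
    field. *)
Lemma toric_idealP f (D : {fset mon}) : (msupp f `<=` D)%fset ->
  toric_ideal f <->
  forall e, \sum_(u <- D | mon_exponent u == e) f@_u = 0.
Proof.
move=> hD.
have E : toric_map f = FracField.tofrac
    (\sum_(u <- D) mpoly.mpolyC _ f@_u * mpoly.mpolyX k (mon_exponent u)).
  rewrite /toric_map /mmap rmorph_sum /= (big_fset_incl _ hD); last first.
    by move=> u _ /mcoeff_outdom ->; rewrite /ratfun_const mpoly.mpolyC0
      rmorph0 mul0r.
  apply: eq_bigr => u _.
  by rewrite mon_image rmorphM.
rewrite /toric_ideal E; split.
  move/eqP; rewrite tofrac_eq0 => /eqP H e.
  have := congr1 (mpoly.mcoeff e) H; rewrite mpoly.mcoeff0 raddf_sum /= => h.
  rewrite -[RHS]h [LHS]big_mkcond; apply: eq_bigr => u _.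
  rewrite mpoly.mcoeffCM mpoly.mcoeffX.
  by case: eqP; rewrite ?mulr1 ?mulr0.
move=> H; apply/eqP; rewrite tofrac_eq0; apply/eqP/mpoly.mpolyP => e.
rewrite mpoly.mcoeff0 raddf_sum /= -[RHS](H e) [RHS]big_mkcond.
apply: eq_bigr => u _; rewrite mpoly.mcoeffCM mpoly.mcoeffX.
by case: eqP; rewrite ?mulr1 ?mulr0.
Qed.

Lemma toric_binom u v : mon_exponent u = mon_exponent v ->
  toric_ideal (binom k u v).
Proof.
move=> e; apply/(@toric_idealP _ [fset u; v]%fset).
  apply/fsubsetP=> w hw; have : (binom k u v)@_w != 0 by rewrite mcoeff_neq0.
  rewrite binom_coeff in_fset2 ![w == _]eq_sym.
  by case: (u == w) => //; case: (v == w) => //; rewrite subrr eqxx.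
move=> d; case: (eqVneq u v) => [<-|ne].
  by apply: big1 => w _; rewrite binom_coeff; apply: subrr.
have fu : (binom k u v)@_u = 1.
  by rewrite binom_coeff eqxx [v == u]eq_sym (negPf ne) subr0.
have fv : (binom k u v)@_v = -1.
  by rewrite binom_coeff eqxx (negPf ne) sub0r.
have uv : u \notin [fset v]%fset by rewrite in_fset1.
rewrite big_mkcond (big_fsetU1 _ _ uv) big_seq_fset1 fu fv e.
by case: eqP => _; [apply: subrr|apply: addr0].
Qed.

(** The coefficients in a fiber sum to 0, so a nonzero one has to be cancelled by another. *)
Lemma toric_msupp f u : toric_ideal f -> u \in msupp f ->
  exists v, [/\ v \in msupp f, v != u & mon_exponent v = mon_exponent u].
Proof.
move=> /(toric_idealP (fsubset_refl _))/(_ (mon_exponent u)) H uf.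
case: (boolP (has (fun v => (v != u) && (mon_exponent v == mon_exponent u))
   (msupp f))) => [/hasP[v vf /andP[vu /eqP e]]|h]; first by exists v.
move: H; rewrite big_mkcond (bigD1_seq u) ?fset_uniq //= eqxx big1_seq.
  by move/eqP; rewrite addr0 mcoeff_eq0 uf.
move=> v /andP[vu vf]; case: ifP => // e; case/hasP: h; exists v => //.
by rewrite vu.
Qed.

End ToricMap.

(** * Lattice points of the transportation polytope *)

Section LatticePoints.
Variables (R : realType) (m n : nat) (r : 'rV[nat]_m) (c : 'rV[nat]_n).
Local Notation I := (lattice_point (transportation_polytope R r c)).
Implicit Types (a : 'M[int]_(m, n)) (u v : {cmonom I}).

Definition int_margins : 'cV[int]_m * 'rV[int]_n :=
  (\col_i (r 0 i)%:Z, \row_j (c 0 j)%:Z).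

Lemma transportation_pointP a :
  transportation_polytope R r c (map_mx intr a) <-> point int_margins a.
Proof.
have sumE (K : finType) (F : K -> int) (p : nat) :
    (\sum_(i : K) (F i)%:~R == p%:R :> R) = (\sum_i F i == p%:Z).
  by rewrite -(eqr_int R) rmorph_sum.
split.
  case/and3P=> /forallP h0 /forallP hc /forallP hr; split; last first.
    by move=> i j; have /forallP/(_ j) := h0 i; rewrite mxE ler0z.
  congr (_, _); apply/matrixP=> i j; rewrite !mxE; apply/eqP.
    by have := hr i; rewrite -sumE; under eq_bigr do rewrite mxE.
  by have := hc j; rewrite -sumE; under eq_bigr do rewrite mxE.
case=> hm h0; apply/and3P; split.
- by apply/forallP=> i; apply/forallP=> j; rewrite mxE ler0z.
- apply/forallP=> j; under eq_bigr do rewrite mxE.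
  by rewrite sumE; case: hm => _ /matrixP/(_ 0 j); rewrite !mxE => /eqP.
- apply/forallP=> i; under eq_bigr do rewrite mxE.
  by rewrite sumE; case: hm => /matrixP/(_ i 0) + _; rewrite !mxE => /eqP.
Qed.

Lemma lattice_point_point (x : I) : point int_margins (val x).
Proof. by apply/transportation_pointP; exact: (valP x). Qed.

Lemma point_lattice_point a : point int_margins a -> exists x : I, val x = a.
Proof. by move=> /transportation_pointP h; exists (Sub a h); rewrite SubK. Qed.

(** Bounds the entries, so that the lattice points can be enumerated. *)
Lemma point_entry_le a i j : point int_margins a ->
  (absz (a i j) <= \sum_k r 0%R k)%N.
Proof.
move=> [[/matrixP/(_ i 0) h _] h0]; move: h; rewrite !mxE => h.
have : a i j <= (r 0 i)%:Z.
  by rewrite -h (bigD1 j) //= lerDl; apply: sumr_ge0 => l _; apply: h0.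
have := h0 i j; have : (r 0%R i <= \sum_k r 0%R k)%N by rewrite (bigD1 i)
  ?leq_addr.
by move: (\sum_k _)%N => K; lia.
Qed.

Lemma exists_sorted_points : exists s : seq I,
  [/\ uniq s, forall x, x \in s & sorted (fun x y => ltm (val x) (val y)) s].
Proof.
pose K := (\sum_k r 0%R k)%N.
pose cand := [seq map_mx (fun i : 'I_K.+1 => (i : nat)%:Z) A
  | A <- enum {: 'M['I_K.+1]_(m, n)}].
pose s0 : seq I := undup (pmap insub cand).
have s0P x : x \in s0.
  rewrite mem_undup mem_pmap_sub; apply/mapP.
  exists (\matrix_(i, j) inord (absz (val x i j))); first by rewrite mem_enum.
  apply/matrixP=> i j; rewrite !mxE inordK.
    by have [_ h] := lattice_point_point x; rewrite gez0_abs.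
  by rewrite ltnS point_entry_le //; apply: lattice_point_point.
pose leI (x y : I) := ~~ ltm (val y) (val x).
have leI_total : total leI.
  move=> x y; rewrite /leI -negb_and; apply/negP=> /andP[h1 h2].
  by have := ltm_trans h1 h2; rewrite ltm_irr.
have leI_trans : transitive leI.
  move=> y x z h1 h2; apply/negP=> h; have := ltm_le_trans h h1.
  by apply/negP; exact: h2.
exists (sort leI s0); split.
- by rewrite sort_uniq undup_uniq.
- by move=> x; rewrite mem_sort.
(* Sorting gives only the nonstrict order; distinctness of the points makes it strict. *)
- apply: pairwise_sorted.
  have h1 : pairwise leI (sort leI s0).
    by rewrite -sorted_pairwise // sort_sorted.
  have h2 : pairwise [rel x y | x != y] (sort leI s0).
    by rewrite -uniq_pairwise sort_uniq undup_uniq.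
  have : pairwise [rel x y | leI x y && (x != y)] (sort leI s0).
    by rewrite pairwise_relI h1 h2.
  apply: sub_pairwise => x y /= /andP[hl ne].
  have := @ltm_total _ _ (val x) (val y); rewrite (inj_eq val_inj) => /(_ ne).
  by rewrite (negPf hl) orbF.
Qed.

Variables (pts : seq I).
Hypotheses (pts_uniq : uniq pts) (pts_all : forall x, x \in pts).
Local Notation mat := (fun x : I => val x).

Lemma expo_entry u i j :
  (mon_exponent u (mxvec_index i j))%:Z = expo pts mat u i j.
Proof.
have hp : perm_eq (items pts u) (flatten [seq nseq (u x) x | x <- finsupp u]).
  apply/allP=> x _; apply/eqP; rewrite /= count_items //.
  rewrite count_flatten -map_comp sumnE big_map.
  case: (finsuppP u x) => [xu|xu].
    rewrite big1_seq // => y /andP[_ yu]; rewrite /= count_nseq /=.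
    by case: eqP => // yx; rewrite yx (negPf xu) in yu.
  rewrite (bigD1_seq x) //= count_nseq /= eqxx mul1n big1 ?addn0 // => y hy.
  by rewrite count_nseq /= (negPf hy).
rewrite /expo /mats big_map summxE (perm_big _ hp) /= big_flatten big_map.
rewrite /mon_exponent mpoly.mnm_sumE -[LHS]natz natr_sum.
apply: eq_bigr => x _ /=.
rewrite natz big_nseq iter_addr_0 mpoly.mulmnE mpoly.mnmE mxvecE.
have [_ h] := lattice_point_point x.
by rewrite -mulr_natr natz PoszM gez0_abs.
Qed.

Lemma expo_exponent u v :
  expo pts mat u = expo pts mat v <-> mon_exponent u = mon_exponent v.
Proof.
split=> h.
  apply/mpoly.mnmP=> l; case/mxvec_indexP: l => i j.
  by apply/eqP; rewrite -eqz_nat !expo_entry h.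
by apply/matrixP=> i j; rewrite -!expo_entry h.
Qed.

(** The margins of [expo pts mat w] are [mdeg w] times the pair [(r, c)], so a nonzero coordinate of
    that pair determines the degree. *)
Lemma expo_degree u v : (r, c) != (0, 0) ->
  expo pts mat u = expo pts mat v -> mdeg u = mdeg v.
Proof.
move=> hrc h.
have mE w : margins (expo pts mat w) = int_margins *+ mdeg w.
  rewrite /expo raddf_sum /= big_map -(size_items pts_uniq pts_all).
  rewrite (eq_bigr (fun=> int_margins)); last first.
    by move=> x _; case: (lattice_point_point x).
  by rewrite big_const_seq count_predT iter_addr_0.
have := mE u; rewrite h mE => /esym e.
have hc (p d d' : nat) : p != 0%N -> p%:Z *+ d = p%:Z *+ d' -> d = d'.
  move=> p0; rewrite -mulr_natr -[in RHS]mulr_natr.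
  have p1 : p%:Z != 0 by rewrite eqz_nat.
  by move=> /(mulfI p1)/eqP; rewrite eqr_nat => /eqP.
have [[i hi]|[j hj]] :
    (exists i, r 0 i != 0%N) \/ (exists j, c 0 j != 0%N).
- case: (pickP (fun i => r 0 i != 0%N)) => [i hi|hr]; first by left; exists i.
  case: (pickP (fun j => c 0 j != 0%N)) => [j hj|hc']; first by right; exists j.
  case/eqP: hrc; congr (_, _); apply/rowP=> k; rewrite mxE.
    by have /negbFE/eqP := hr k.
  by have /negbFE/eqP := hc' k.
- apply: (hc _ _ _ hi); have /(congr1 (fun q : 'cV[int]_m * 'rV[int]_n => q.1 i
    0)) := e.
  by rewrite !pairMnE /= !mulmxnE !mxE.
- apply: (hc _ _ _ hj); have /(congr1 (fun q : 'cV[int]_m * 'rV[int]_n => q.2 0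
    j)) := e.
  by rewrite !pairMnE /= !mulmxnE !mxE.
Qed.

End LatticePoints.

(** * From minimal generators to the reduced Groebner basis *)

Theorem mainTheorem7 (k : fieldType) (R : realType) (m n : nat)
    (hm : (0 < m)%N) (hn : (0 < n)%N)
    (r : 'rV[nat]_m) (c : 'rV[nat]_n) (hrc : (r, c) != (0, 0)) :
  exists2 le : rel {cmonom (lattice_point (transportation_polytope R r c))},
    term_order le &
    exists G : {fset {malg k[{cmonom (lattice_point
                                        (transportation_polytope R r c))}]}},
      [/\ reduced_groebner_basis le
            (toric_ideal (P := transportation_polytope R r c)) G,
          forall g, g \in G -> squarefree_mon (lead_mon le g)
        & forall g, g \in G -> (total_degree g <= (m * n)./2)%N].
Proof.
have [pts [pts_uniq pts_all pts_sorted]] := exists_sorted_points R r c.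
pose I := lattice_point (transportation_polytope R r c).
pose mat := fun x : I => val x : 'M[int]_(m, n).
pose mu := int_margins r c.
pose le := mle pts mat.
have hdeg u v : expo pts mat u = expo pts mat v -> mdeg u = mdeg v.
  exact: expo_degree.
have mat_inj : injective mat by exact: val_inj.
have mat_point x : point mu (mat x) by exact: lattice_point_point.
have point_mat a : point mu a -> exists x, mat x = a.
  exact: point_lattice_point.
have le_order : term_order le by apply: mle_term_order.
have nonneg (x : I) i j : 0 <= val x i j by have [_] := mat_point x; apply.
pose red := reducible pts mat; pose minred := min_reducible pts mat.
pose std u := sval (boolp.cid (exists_standard pts_uniq pts_all hdeg u)).
have stdP u : [/\ expo pts mat (std u) = expo pts mat u, ~ red (std u)
    & u = std u \/ mlt pts mat (std u) u].
  exact: svalP (boolp.cid (exists_standard pts_uniq pts_all hdeg u)).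
have bound u : minred u -> squarefree_mon u /\ (mdeg u <= (m * n)./2)%N.
  exact: (min_reducible_bound (mu := mu)).
(* The degree bound confines the minimal generators to a finite list, so the basis is a finite
   set. *)
pose L := flatten [seq monomials pts d | d <- iota 0 (m * n)./2.+1].
have minred_L u : minred u -> u \in L.
  move=> /bound[_ h]; apply/flatten_mapP; exists (mdeg u).
    by rewrite mem_iota.
  exact: mem_monomials.
have minred_red u : minred u -> red u by case.
have std_neq u : minred u -> u != std u.
  move=> h; apply/eqP=> e; have [_ irr _] := stdP u.
  by apply: irr; rewrite -e; apply: minred_red.
have std_lt u : minred u -> mlt pts mat (std u) u.
  by move=> h; have [_ _ [e|//]] := stdP u; case/eqP: (std_neq _ h).
have lt_le u v : mlt pts mat u v -> le u v.
  by move=> h; apply/negP=> h'; have := mlt_trans h h'; rewrite mlt_irr.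
exists le => //.
exists (reduced_basis k minred std L); split.
- apply: (@reduced_basisP k I le le_order _ red) => //.
  (* Another monomial of [f] lies in the fiber of the leading one and is smaller, so the leading one
     is reducible. *)
  + move=> f hf f0.
    have [v [vf ne e]] := toric_msupp nonneg hf (lead_mon_mem le_order f0).
    exists v; first exact/(expo_exponent pts_uniq pts_all).
    have h : ~~ mlt pts mat (lead_mon le f) v := lead_mon_ge le_order vf.
    by case/orP: (mlt_total mat pts_all ne) => // h'; rewrite h' in h.
  + by move=> u; apply: exists_min_reducible.
  + by move=> u v; apply: reducibleM.
  + by move=> w v [_ h] v1; apply: (h w v).
  + move=> u hu; apply: toric_binom => //; apply/(expo_exponent pts_uniq
      pts_all).
    by have [e _ _] := stdP u; exact: esym e.
  + by move=> u /std_lt/lt_le.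
  + by move=> u _; have [_ ? _] := stdP u.
- move=> g /(mem_reduced_basis std minred_L)[u hu ->].
  rewrite lead_mon_binom ?std_neq ?lt_le ?std_lt //.
  by case: (bound u hu).
move=> g /(mem_reduced_basis std minred_L)[u hu ->].
have [_ hd] := bound u hu; apply: leq_trans hd.
(* As [msize] exceeds the degree by one, the target is [(mdeg u).+1]; [u] and [std u] share a fiber
   and hence a degree. *)
rewrite /total_degree -ltnS; apply: (@leq_trans (mdeg u).+1); last by [].
have : (msize (binom k u (std u)) <= (mdeg u).+1)%N.
  rewrite msizeE; apply/bigmax_leqP_seq => v + _.
  rewrite mem_msupp_binom ?std_neq // ltnS => /orP[/eqP->//|/eqP->].
  by have [e _ _] := stdP u; rewrite (hdeg _ _ e).
by case: msize.
Qed.
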